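(* Let $\mathcal B$ be a unital $C^*$-algebra with norm $\|\cdot\|$, let $(\mathcal A, E:\mathcal A\to\mathcal B)$ be a $\mathcal B$-valued probability space, and let $S,T$ be index sets. For each $n\in\mathbb N$ let $\{a(i,j;s,n): s\in S,\ 1\le i,j\le n\}$ be a family of elements of $\mathcal A$ such that: (Y1) $a(i,j;s,n)=a(j,i;s,n)^*$ for all $1\le i,j\le n$, $s\in S$; (Y2) $E[a(i,j;s,n)]=0$ for all $1\le i,j\le n$, $s\in S$; (Y3) for each $s\in S$ there is a completely positive map $\eta_s:\mathcal B\to\mathcal B$ (independent of $i,j,n$) such that $E[a(i,j;s,n)\,b\,a(j,i;s,n)]=\frac1n\eta_s(b)$ for all $b\in\mathcal B$, $1\le i,j\le n$; (Y4) for each $m\in\mathbb N$ there is $M_m>0$ such that for all $n$ and all $b_1,\dots,b_{m-1}\in\mathcal B$, $$\sup_{\substack{s_1,\dots,s_m\in S\\ 1\le i_1,\dots,i_m,j_1,\dots,j_m\le n}}\big\|E[a(i_1,j_1;s_1,n)b_1a(i_2,j_2;s_2,n)b_2\cdots b_{m-1}a(i_m,j_m;s_m,n)]\big\|\le M_m n^{-m/2}\prod_{k=1}^{m-1}\|b_k\|;$$ (Y5) for each $n$, the family $\{a(i,j;s,n): s\in S,\ 1\le i\le j\le n\}$ is Boolean independent over $\mathcal B$. Put $Z(s,n)=\sum_{1\le i,j\le n}a(i,j;s,n)\otimes e(i,j;n)\in\mathcal A\otimes M_n(\mathbb C)$. Then, with respect to $E_n$, the joint distributions of $\{Z(s,n)\}_{s\in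 S}$ converge weakly in norm, as $n\to\infty$, to the joint distribution of a family $\{Z_s\}_{s\in S}$ of Boolean independent $\mathcal B$-valued Bernoulli random variables. In addition, for $t\in T$ and $n\in\mathbb N$ let $D(t,n)=\sum_{1\le i\le n}b(i;t,n)\otimes e(i,i;n)\in\mathcal B\otimes M_n(\mathbb C)$, $b(i;t,n)\in\mathcal B$, be such that: (D1) the joint distribution of $\{D(t,n)\}_{t\in T}$ with respect to $E_n$ converges weakly in norm to the joint distribution of a family $\{D_t\}_{t\in T}$; (D2) $\lim_{n\to\infty}\frac{\|D(t,n)\|^k}{n}=0$ for all $t\in T$, $k\in\mathbb N$; (D3) $\limsup_{n\to\infty}\frac1n\sum_{i=1}^n\|b(i;t,n)\|^k<\infty$ for all $t\in T$, $k\in\mathbb N$. Then the joint distribution of $\{Z(s,n)\}_{s\in S}\cup\{D(t,n)\}_{t\in T}$ with respect to $E_n$ converges weakly in norm to the joint distribution of families $\{Z_s\}_{s\in S}\cup\{D_t\}_{t\in T}$ in a $\mathcal B$-valued probability space $(\mathbb A,\mathbb E:\mathbb A\to\mathcal B)$ satisfying, for all $m\ge1$, all $\bar s=(s_1,\dots,s_m)\in S^m$ and all $P_1,\dots,P_{m+1}$ in the algebra generated by $\{D_t\}_{t\in T}$ and $\mathcal B$, $$\mathbb E[P_1Z_{s_1}P_2Z_{s_2}\cdots P_mZ_{s_m}P_{m+1}]=\mathbb E\big[P_1\,\eta_{s_1}(\mathbb E[P_2])\,P_3\,\eta_{s_3}(\mathbb E[P_4])\cdots P_{m-1}\,\eta_{s_{m-1}}(\mathbb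 E[P_m])\,P_{m+1}\big]$$ if $m$ is even and $\ker\bar s\ge 1_{IN_2(m)}$ (i.e. $s_1=s_2,\ s_3=s_4,\dots,s_{m-1}=s_m$), and $\mathbb E[P_1Z_{s_1}P_2Z_{s_2}\cdots P_mZ_{s_m}P_{m+1}]=0$ otherwise.
   Context: $\mathcal B$-valued probability space $(\mathcal A,E)$: $\mathcal B$ is a unital $C^*$-algebra, $\mathcal A$ is a unital $*$-algebra which is also a $\mathcal B$-bimodule ($\mathcal B$ is regarded as a subalgebra of $\mathcal A$ via $b\mapsto b1_{\mathcal A}$), and $E:\mathcal A\to\mathcal B$ is a linear map with $E[b_1ab_2]=b_1E[a]b_2$, $E[b1_{\mathcal A}]=b$, and $E[aa^*]\ge0$ for all $a\in\mathcal A$, $b,b_1,b_2\in\mathcal B$. Elements of $\mathcal A$ are called ($\mathcal B$-valued) random variables. $e(i,j;n)$ are the matrix units of $M_n(\mathbb C)$. $E_n:\mathcal A\otimes M_n(\mathbb C)\to\mathcal B$ is $E_n[(a_{i,j})_{i,j=1}^n]=\frac1n\sum_{i=1}^nE[a_{i,i}]$; $\mathcal A\otimes M_n(\mathbb C)=M_n(\mathcal A)$ is a $\mathcal B$-bimodule by $b_1(a_{ij})b_2=(b_1a_{ij}b_2)$, and $(M_n(\mathcal A),E_n)$ is a $\mathcal B$-valued probability space; $\mathcal B\otimes M_n(\mathbb C)$ is viewed inside it and $\|D(t,n)\|$ is the $C^*$-norm of $\mathcal B\otimes M_n(\mathbb C)$. $\mathcal B\langle X_i,X_i^*: i\in I\rangle$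 is the $*$-algebra freely generated by $\mathcal B$ and noncommuting indeterminates $X_i,X_i^*$; its elements are called $\mathcal B$-polynomials, and the subscript $0$ denotes the subalgebra of those without constant term. The joint distribution of a family $(x_i)_{i\in I}$ in $(\mathcal A,E)$ is the map $\mu(p)=E[p((x_i)_{i\in I})]$ on $\mathcal B$-polynomials. Joint distributions $\mu_n$ converge weakly in norm to $\mu$ if $\mu_n(p)\to\mu(p)$ in the norm of $\mathcal B$ for every $\mathcal B$-polynomial $p$. Random variables $(x_i)_{i\in I}$ are Boolean independent over $\mathcal B$ if $E[P_1(x_{i_1})\cdots P_n(x_{i_n})]=E[P_1(x_{i_1})]\cdots E[P_n(x_{i_n})]$ whenever $i_1\ne i_2\ne\cdots\ne i_n$ and $P_1,\dots,P_n\in\mathcal B\langle X,X^*\rangle_0$. Partitions: $[m]=\{1,\dots,m\}$. $IN(m)$ is the set of interval partitions of $[m]$ (every block consists of consecutive integers), $IN_2(m)$ those all of whose blocks have exactly 2 elements; $IN_2(m)=\emptyset$ for $m$ odd, and for $m$ even its only element is $1_{IN_2(m)}=\{\{1,2\},\{3,4\},\dots,\{m-1,m\}\}$. $\ker\bar s$ is the partition of $[m]$ whose blocks are the classes of $p\sim q\Leftrightarrow s_p=s_q$. $\pi\le\sigma$ means each block of $\pi$ is contained in a block of $\sigma$. Boolean cumulants: for $n$-$\mathcal B$-linear maps $\rho^{(n)}$ and $\pi\in IN(n)$ define recursively $\rho^{(\{[n]\})}=\rho^{(n)}$ and otherwise $\rho^{(\pi)}(a_1,\dots,a_n)=\rho^{(\pi\setminus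 V)}(a_1,\dots,a_l\,\rho^{(r)}(a_{l+1},\dots,a_{l+r}),a_{l+r+1},\dots,a_n)$ for a block $V=\{l+1,\dots,l+r\}$ (if $l=0$ the value multiplies $a_{r+1}$ from the left). The Boolean cumulants $b_E^{(n)}$ are defined recursively by $b_E^{(n)}(a_1,\dots,a_n)=E[a_1\cdots a_n]-\sum_{\pi\in IN(n),\pi\ne\{[n]\}}b_E^{(\pi)}(a_1,\dots,a_n)$. A family $\{Z_s\}_{s\in S}$ of selfadjoint random variables is a family of Boolean independent (centered) $\mathcal B$-valued Bernoulli random variables if for all $m\ge1$, $\bar s\in S^m$, $b_1,\dots,b_{m+1}\in\mathcal B$ and $\pi\in IN(m)$, $b_E^{(\pi)}(b_1Z_{s_1},\dots,b_mZ_{s_m}b_{m+1})=0$ unless $\pi\in IN_2(m)$ and $\pi\le\ker\bar s$. *)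

(* Defs.v *)
From HB Require Import structures.
From mathcomp Require Import all_boot all_order all_algebra.
From mathcomp Require Import all_classical all_reals all_analysis.
From mathcomp Require Export complex.

Set Implicit Arguments.
Unset Strict Implicit.
Unset Printing Implicit Defensive.

Import Order.TTheory GRing.Theory Num.Theory.
Import numFieldNormedType.Exports.

Local Open Scope classical_set_scope.
Local Open Scope ring_scope.

(* As [algType] extends [nzRingType], all algebras below are nonzero. *)
HB.mixin Record isStarAlgebra (R : realType) A of GRing.Algebra R[i] A := {
  star : A -> A;
  starK : involutive star;
  starD : {morph star : x y / x + y};
  starM : forall x y, star (x * y) = star y * star x;
  starZ : forall (c : R[i]) x, star (c *: x) = c^* *: star x
}.

#[short(type="starAlgType")]
HB.structure Definition StarAlgebra (R : realType) :=
  {A of GRing.Algebra R[i] A & isStarAlgebra R A}.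

(* The norm is a new operation: Hierarchy-Builder rejects a join of [algType] and
   [normedModType], as [numDomainType] already inherits from a ring and a norm.
   On [R[i]], [`|c|] is in [R[i]], with zero imaginary part. *)
HB.mixin Record isCStarAlgebra (R : realType) A of StarAlgebra R A := {
  cnorm : A -> R;
  cnorm0_eq0 : forall x, cnorm x = 0 -> x = 0;
  cnormD : forall x y, cnorm (x + y) <= cnorm x + cnorm y;
  cnormZ : forall (c : R[i]) x, cnorm (c *: x) = complex.Re `|c| * cnorm x;
  cnormM : forall x y, cnorm (x * y) <= cnorm x * cnorm y;
  cnorm_star : forall x, cnorm (star x * x) = cnorm x ^+ 2;
  cnorm_complete : forall u : nat -> A,
    (forall e : R, 0 < e -> exists N : nat, forall m n,
       (N <= m)%N -> (N <= n)%N -> cnorm (u m - u n) < e) ->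
    exists l, cnorm (u n - l) @[n --> \oo] --> (0 : R)
}.

#[short(type="cstarAlgType")]
HB.structure Definition CStarAlgebra (R : realType) :=
  {A of StarAlgebra R A & isCStarAlgebra R A}.

Section Positivity.
Context (R : realType).

Definition invertible (U : pzRingType) (x : U) : Prop :=
  exists y, x * y = 1 /\ y * x = 1.

(* [sc] is the inclusion of the scalars in [U]. It is explicit because the
   canonical scaling on matrices over [B] is by elements of [B]. *)
Definition spectrum (U : pzRingType) (sc : R[i] -> U) (x : U) : set R[i] :=
  [set l | ~ invertible (x - sc l)].

(* In [R[i]], [0 <= l] means that [l] is real and nonnegative. *)
Definition positive_in (U : pzRingType) (sc : R[i] -> U) (st : U -> U) (x : U) :
  Prop := st x = x /\ spectrum sc x `<=` [set l | 0 <= l].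

Definition positive (A : starAlgType R) (x : A) : Prop :=
  positive_in (fun l => l%:A) (@star R A) x.

Definition mxstar (A : starAlgType R) n (M : 'M[A]_n) : 'M[A]_n :=
  (map_mx (@star R A) M)^T.

Definition mx_positive (A : starAlgType R) n (M : 'M[A]_n) : Prop :=
  positive_in (fun l => (l%:A : A)%:M) (@mxstar A n) M.

Definition completely_positive (B : cstarAlgType R) (f : {linear B -> B}) :
  Prop := forall n (M : 'M[B]_n), mx_positive M -> mx_positive (map_mx f M).

End Positivity.

Section MatrixNorm.
Context (R : realType) (B : cstarAlgType R) (n : nat).

(* The norm of the Hilbert [B]-module [B^n]. *)
Definition colnorm (v : 'cV[B]_n) : R :=
  Num.sqrt (cnorm (\sum_i star (v i 0) * v i 0)).

(* The C*-norm of [M_n(B)], as the operator norm on [B^n]. *)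
Definition mx_cstar_norm (M : 'M[B]_n) : \bar R :=
  ereal_sup [set (colnorm (M *m v))%:E | v in [set v | colnorm v <= 1]].

End MatrixNorm.

Record bprobSpace (R : realType) (B : cstarAlgType R) := BProbSpace {
  bps_alg :> starAlgType R;
  binj : {lrmorphism B -> bps_alg};
  bexp : {linear bps_alg -> B};
  binj_star : forall b, binj (star b) = star (binj b);
  bexp_bimod : forall b1 a b2, bexp (binj b1 * a * binj b2) = b1 * bexp a * b2;
  bexp_binj : forall b, bexp (binj b) = b;
  bexp_pos : forall a, positive (bexp (a * star a))
}.

Arguments binj {R B} _.
Arguments bexp {R B} _.

(* The elements of the *-algebra freely generated by [B] and the [X_i], [X_i^*]
   are classes of such expressions; below, an expression is only used through
   its values, which depend on its class alone. *)
Inductive bpoly (B I : Type) : Type :=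
  | BConst of B
  | BVar of I
  | BVarStar of I
  | BAdd of bpoly B I & bpoly B I
  | BMul of bpoly B I & bpoly B I.

Arguments BVar {B I} _.
Arguments BVarStar {B I} _.
Arguments BConst {B I} _.

Fixpoint beval (B I : Type) (U : pzRingType) (inj : B -> U) (st : U -> U)
    (x : I -> U) (p : bpoly B I) : U :=
  match p with
  | BConst b => inj b
  | BVar i => x i
  | BVarStar i => st (x i)
  | BAdd p q => beval inj st x p + beval inj st x q
  | BMul p q => beval inj st x p * beval inj st x q
  end.

(* The value at [X = X^* = 0]. *)
Definition const_term (B : pzRingType) (I : Type) (p : bpoly B I) : B :=
  beval id id (fun=> 0) p.

Definition family_sum (S T U : Type) (f : S -> U) (g : T -> U) (i : S + T) : U :=
  match i with inl s => f s | inr t => g t end.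

Section Laws.
Context (R : realType) (B : cstarAlgType R) (A : bprobSpace B) (I : Type).

Definition law (x : I -> A) (p : bpoly B I) : B :=
  bexp A (beval (binj A) star x p).

Definition mx_bexp n (M : 'M[A]_n) : B :=
  (n%:R^-1 : R[i]) *: \sum_i bexp A (M i i).

Definition mx_law n (x : I -> 'M[A]_n) (p : bpoly B I) : B :=
  mx_bexp (beval (fun b => (binj A b)%:M) (@mxstar R A n) x p).

Definition weak_cvg (mu : nat -> bpoly B I -> B) (nu : bpoly B I -> B) : Prop :=
  forall p, cnorm (mu n p - nu p) @[n --> \oo] --> (0 : R).

Definition boolean_independent (x : I -> A) : Prop :=
  forall (n : nat) (i : nat -> I) (P : nat -> bpoly B unit),
    (forall k, (k.+1 < n)%N -> i k <> i k.+1) ->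
    (forall k, const_term (P k) = 0) ->
    let y k := beval (binj A) star (fun=> x (i k)) (P k) in
    bexp A (\prod_(k < n) y k) = \prod_(k < n) bexp A (y k).

(* The subalgebra generated by the image of [B] and the values of [x]. *)
Definition is_subalgebra (V : set A) : Prop :=
  [/\ V 1, forall a b, V a -> V b -> V (a + b),
      forall a b, V a -> V b -> V (a * b)
    & forall (c : R[i]) a, V a -> V (c *: a)].

Definition gen_algebra (x : I -> A) : set A :=
  smallest is_subalgebra (range (binj A) `|` range x).

End Laws.

(* An interval partition of [m] is encoded by the sequence of the sizes of its
   blocks, from left to right. Those of [m.+1] are obtained from those of [m] by
   either adding a first block of size 1 or enlarging the first block. *)
Fixpoint intpart (m : nat) : seq (seq nat) :=
  if m is m'.+1 then
    [seq 1%N :: c | c <- intpart m'] ++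
    [seq (head 0%N c).+1 :: behead c | c <- intpart m' & c != [::]]
  else [:: [::]].

Lemma mem_intpart m c : (c \in intpart m) = (0 \notin c) && (sumn c == m).
Proof.
elim: m c => [|m IH] c /=.
  by case: c => [|[|r] c] //=; rewrite in_cons /= andbF.
rewrite mem_cat; apply/orP/andP => [[/mapP[d]|/mapP[d]]|[]].
- by rewrite IH => /andP[d0 /eqP <-] ->; rewrite in_cons d0 /= add1n.
- rewrite mem_filter IH => /andP[dn /andP[d0 /eqP <-]] ->.
  by case: d dn d0 => //= r d _; rewrite !in_cons !negb_or => /andP[_ ->].
case: c => [|[|[|r]] c] //=; rewrite ?in_cons //= => c0.
  rewrite add1n eqSS => cm; left; apply/mapP; exists c => //.
  by rewrite IH c0.
rewrite addSn eqSS => cm; right; apply/mapP; exists (r.+1 :: c) => //.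
by rewrite mem_filter IH /= in_cons c0 cm.
Qed.

Lemma intpart_uniq m : uniq (intpart m).
Proof.
elim: m => //= m IH; rewrite cat_uniq map_inj_uniq => [|c d []//].
rewrite IH /= map_inj_in_uniq ?filter_uniq // => [|c d].
  rewrite andbT; apply/hasPn => _ /mapP[c + ->].
  rewrite mem_filter mem_intpart => /and3P[c0 cp _].
  by apply/mapP => -[d _ []]; case: c c0 cp => //= -[|r] c.
by rewrite !mem_filter; case: c => // r c; case: d => // r' d _ _ [-> ->].
Qed.

(* The partition encoded by [c] is finer than the kernel of [s]. *)
Definition le_ker (S : Type) (c : seq nat) (s : nat -> S) : Prop :=
  forall p q, (p < sumn c)%N -> (q < sumn c)%N ->
    reshape_index c p = reshape_index c q -> s p = s q.

Section Cumulants.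
Context (R : realType) (B : cstarAlgType R) (A : bprobSpace B).

Definition mul_head (b : B) (a : seq A) : seq A :=
  if a is x :: a' then binj A b * x :: a' else [::].

(* [rho^(pi)], where [pi] is encoded by [c]; the removed block is the first. *)
Fixpoint multi_ext (rho : seq A -> B) (c : seq nat) (a : seq A) : B :=
  match c with
  | [::] => 1
  | r :: c' => if c' is [::] then rho a
               else multi_ext rho c' (mul_head (rho (take r a)) (drop r a))
  end.

(* [k] bounds the depth of the recursion; see [bcumulantE]. *)
Fixpoint bcumulant_rec (k : nat) (a : seq A) : B :=
  if k is k'.+1 then
    bexp A (\prod_(x <- a) x) -
    \sum_(c <- intpart (size a) | c != [:: size a])
      multi_ext (bcumulant_rec k') c a
  else 0.

Definition bcumulant (a : seq A) : B := bcumulant_rec (size a) a.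

Lemma eq_multi_ext (rho rho' : seq A -> B) c a :
  {in c, forall r (a' : seq A), size a' = r -> rho a' = rho' a'} ->
  size a = sumn c -> multi_ext rho c a = multi_ext rho' c a.
Proof.
elim: c a => //= r c IH a eq_rho sz_a.
case: c IH eq_rho sz_a => [|r' c] IH eq_rho sz_a.
  by apply: eq_rho (mem_head _ _) _ _; rewrite sz_a /= addn0.
rewrite IH.
- rewrite (eq_rho r (mem_head _ _)) // size_take sz_a; case: ltnP => //= h.
  by apply/eqP; rewrite eqn_leq h leq_addr.
- by move=> q qc; apply: eq_rho; rewrite in_cons qc orbT.
- have -> : forall b a', size (mul_head b a') = size a' by move=> b [].
  by rewrite size_drop sz_a addKn.
Qed.

Lemma intpart_part_lt m c r :
  c \in intpart m -> c != [:: m] -> r \in c -> (r < m)%N.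
Proof.
rewrite mem_intpart => /andP[c0 /eqP <-] c1 rc.
have le_sumn (d : seq nat) q : q \in d -> (q <= sumn d)%N.
  elim: d => //= x d IH; rewrite in_cons => /orP[/eqP ->|/IH h].
    exact: leq_addr.
  exact: leq_trans h (leq_addl _ _).
case: c c0 c1 rc => [|x [|y c]] //=; first by rewrite addn0 eqxx.
rewrite !in_cons !negb_or => /and3P[x0 y0 _] _.
case/or3P => [/eqP ->|/eqP ->|/le_sumn h].
- by rewrite -[ltnLHS]addn0 ltn_add2l addn_gt0 lt0n eq_sym y0.
- by rewrite addnCA -[ltnLHS]addn0 ltn_add2l addn_gt0 lt0n eq_sym x0.
- apply: leq_ltn_trans h _; rewrite addnA -[ltnLHS]add0n ltn_add2r.
  by rewrite addn_gt0 lt0n eq_sym x0.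
Qed.

Lemma bcumulantE a : (0 < size a)%N ->
  bcumulant a = bexp A (\prod_(x <- a) x) -
    \sum_(c <- intpart (size a) | c != [:: size a]) multi_ext bcumulant c a.
Proof.
have rec_stable k k' a' : (size a' <= k)%N -> (size a' <= k')%N ->
    (0 < size a')%N -> bcumulant_rec k a' = bcumulant_rec k' a'.
  elim: k k' a' => [|k IH] [|k'] a' //=; try by rewrite ?leqn0 => /eqP-> //.
    by move=> _; rewrite leqn0 => /eqP ->.
  move=> lek lek' _; congr (_ - _); rewrite big_seq_cond [RHS]big_seq_cond.
  apply: eq_bigr => c /andP[cin cn]; apply: eq_multi_ext.
    move=> r rc a'' sz''; have ltr := intpart_part_lt cin cn rc.
    apply: IH; rewrite sz''.
    - by rewrite -ltnS (leq_trans ltr).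
    - by rewrite -ltnS (leq_trans ltr).
    - rewrite lt0n; apply: contraTN rc => /eqP ->.
      by move: cin; rewrite mem_intpart => /andP[].
  by move: cin; rewrite mem_intpart => /andP[_ /eqP].
rewrite {1}/bcumulant; case sz_a: (size a) => [//|k] _ /=.
congr (_ - _); rewrite sz_a big_seq_cond [RHS]big_seq_cond.
apply: eq_bigr => c /andP[cin cn]; apply: eq_multi_ext.
  move=> r rc a' sz'; have ltr := intpart_part_lt cin cn rc.
  apply: rec_stable => //; rewrite sz' //.
  rewrite lt0n; apply: contraTN rc => /eqP ->.
  by move: cin; rewrite mem_intpart => /andP[].
by rewrite sz_a; move: cin; rewrite mem_intpart => /andP[_ /eqP].
Qed.

(* [b_1 Z_{s_1}, ..., b_{m-1} Z_{s_{m-1}}, b_m Z_{s_m} b_{m+1}], from index 0 *)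
Definition bernoulli_args (S : Type) (Z : S -> A) m (s : nat -> S)
    (b : nat -> B) : seq A :=
  mkseq (fun k => binj A (b k) * Z (s k) *
                  (if k.+1 == m then binj A (b m) else 1)) m.

Definition boolean_bernoulli (S : Type) (Z : S -> A) : Prop :=
  (forall s, star (Z s) = Z s) /\
  forall (m : nat) (s : nat -> S) (b : nat -> B) (c : seq nat),
    (0 < m)%N -> c \in intpart m ->
    ~ (all (pred1 2%N) c /\ le_ker c s) ->
    multi_ext bcumulant c (bernoulli_args Z m s b) = 0.

End Cumulants.

(* Main.v *)
Require Import Defs.
From HB Require Import structures.
From mathcomp Require Import all_boot all_order all_algebra.
From mathcomp Require Import all_classical all_reals all_analysis.
From mathcomp Require Import complex.
From mathcomp Require Import ring lra.

Set Implicit Arguments.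
Unset Strict Implicit.
Unset Printing Implicit Defensive.

Import Order.TTheory GRing.Theory Num.Theory.
Import numFieldNormedType.Exports.

Local Open Scope classical_set_scope.
Local Open Scope ring_scope.

(** The expectation of a word [P_1 Z_(s_1) P_2 ... Z_(s_m) P_(m+1)] in the
    random and the diagonal matrices is a normalized sum over closed paths
    [i_0, i_1, ..., i_m = i_0] of indices: the [k]-th step of a path carries the
    entry [a(i_(k-1), i_k; s_k)], and its edge is the label [s_k] with the
    unordered pair [{i_(k-1), i_k}].  Cut a path into its maximal runs of steps
    along a same edge.  By Boolean independence the expectation of the path is
    the product of those of its runs, and a run of length 1 is centered.  So
    only paths whose runs all have length at least 2 count ([path_vanish]).
    Two successive steps along a same edge go back to where they started, hence
    every run contributes at most one new index, and a path with [r] runs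
    leaves at most [1 + r] free indices.  As a path has expectation of order
    [n^(-m/2)] and the trace divides by [n], only [r = m/2] survives: all runs
    have exactly two steps [i, j, i], and the labels agree in pairs.  The sum
    over [j] of such a run turns [P] into [eta_s (E_n P)] ([path_prod_val],
    [trace_sum_path_val]).  The other paths are counted in [count_excess]; they
    cost a factor [n^(-1/2)], which beats the diagonal entries because these
    grow slower than every power of [n] ([mx_bexp_word_estimate], [word_cvg]).
    In the surviving term the means [E_n P] converge and the power means of the
    diagonal entries are bounded, whence its limit ([mean_pairing_cvg]).  A
    general polynomial is a sum of such words ([normal_formE]).

    The limit variables live in the algebra of all sequences
    [(p (Z(n), D(n)))_n], [p] a polynomial, with expectation the limit of the
    [E_n] ([weak_limit_realization]): no Fock space has to be built, and
    selfadjointness holds term by term.  Positivity of the limit expectation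
    requires that the positive elements of a C*-algebra, defined by their
    spectrum, form a closed convex cone.  This follows from the description of
    positive elements by [|t - x| <= t], and comes down to the fact that [1] or
    [-1] is in the spectrum of a selfadjoint element of norm 1
    ([not_invertible_1_sub_sqr]), which has a short proof by the Cayley
    transform.

    Finally, the moments of the limit variables determine their Boolean
    cumulants; by induction on the length only the cumulants of order 2 survive
    ([bcumulant_moment_args]), which is the Bernoulli property. *)

(** * Star and norm of a C*-algebra *)

Section StarAlgebra.
Context (R : realType) (A : starAlgType R).
Implicit Types x y : A.

Lemma star0 : star (0 : A) = 0.
Proof. by apply: (addrI (star 0)); rewrite -starD !addr0. Qed.

Lemma starN x : star (- x) = - star x.
Proof. by apply: (addrI (star x)); rewrite -starD !subrr star0. Qed.

Lemma starB x y : star (x - y) = star x - star y.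
Proof. by rewrite starD starN. Qed.

Lemma star1 : star (1 : A) = 1.
Proof. by rewrite -[LHS]mulr1 -{2}(starK 1) -starM mulr1 starK. Qed.

Lemma star_sum (I : Type) (r : seq I) (P : pred I) (F : I -> A) :
  star (\sum_(i <- r | P i) F i) = \sum_(i <- r | P i) star (F i).
Proof. exact: (big_morph _ (@starD _ _) star0). Qed.

Lemma star_rscale (r : R) x : star (r%:C%C *: x) = r%:C%C *: star x.
Proof.
rewrite starZ; congr (_ *: _); apply/conj_Creal.
by rewrite complex_real.
Qed.

Lemma star_exp x k : star x = x -> star (x ^+ k) = x ^+ k.
Proof.
move=> xs; elim: k => [|k IH]; first by rewrite !expr0 star1.
by rewrite [in LHS]exprS starM IH xs -exprSr.
Qed.

End StarAlgebra.

Section Norm.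
Context (R : realType) (B : cstarAlgType R).
Implicit Types x y : B.

Lemma Re_norm_real (r : R) : complex.Re `|r%:C%C| = `|r|.
Proof. by rewrite normc_def /= expr0n addr0 sqrtr_sqr. Qed.

Lemma cnorm_rscale (r : R) x : cnorm (r%:C%C *: x) = `|r| * cnorm x.
Proof. by rewrite cnormZ Re_norm_real. Qed.

Lemma cnorm0 : cnorm (0 : B) = 0.
Proof. by rewrite -(scale0r (0 : B)) cnormZ normr0 mul0r. Qed.

Lemma cnormN x : cnorm (- x) = cnorm x.
Proof. by rewrite -scaleN1r cnormZ normrN1 mul1r. Qed.

Lemma cnormBC x y : cnorm (x - y) = cnorm (y - x).
Proof. by rewrite -cnormN opprB. Qed.

Lemma cnorm_ge0 x : 0 <= cnorm x.
Proof.
have := cnormD x (- x); rewrite subrr cnorm0 cnormN; lra.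
Qed.

Lemma cnormB_le x y : cnorm (x - y) <= cnorm x + cnorm y.
Proof. by rewrite -(cnormN y) cnormD. Qed.

Lemma cnorm_le_dist x y z : cnorm (x - z) <= cnorm (x - y) + cnorm (y - z).
Proof. by rewrite (le_trans _ (cnormD _ _)) // addrA subrK. Qed.

Lemma cnorm_sum (I : Type) (r : seq I) (P : pred I) (F : I -> B) :
  cnorm (\sum_(i <- r | P i) F i) <= \sum_(i <- r | P i) cnorm (F i).
Proof.
elim/big_rec2: _ => [|i u v _ le_uv]; first by rewrite cnorm0.
by rewrite (le_trans (cnormD _ _)) // lerD2l.
Qed.

Lemma cnorm1 : cnorm (1 : B) = 1.
Proof.
have := cnorm_star (1 : B); rewrite star1 mul1r => h.
have n0 : cnorm (1 : B) != 0.
  by apply/negP => /eqP /cnorm0_eq0 /eqP; rewrite oner_eq0.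
by apply: (mulfI n0); rewrite mulr1 -expr2.
Qed.

Lemma cnorm_starE x : cnorm (star x) = cnorm x.
Proof.
have le_star y : cnorm y <= cnorm (star y).
  have [->|y0] := eqVneq y 0; first by rewrite star0 lexx.
  have ny : 0 < cnorm y.
    by rewrite lt_def cnorm_ge0 andbT; apply: contra_neq y0 => /cnorm0_eq0.
  by have := cnormM (star y) y; rewrite cnorm_star expr2 ler_pM2r.
by apply/le_anti; rewrite le_star -{2}(starK x) le_star.
Qed.

Lemma cnormX_le x k : cnorm (x ^+ k) <= cnorm x ^+ k.
Proof.
elim: k => [|k IH]; first by rewrite !expr0 cnorm1.
by rewrite !exprS (le_trans (cnormM _ _)) // ler_wpM2l // cnorm_ge0.
Qed.

Lemma cnorm_sqr_selfadjoint x : star x = x -> cnorm (x ^+ 2) = cnorm x ^+ 2.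
Proof. by move=> xs; rewrite -cnorm_star xs. Qed.

Lemma cnorm_pow2_selfadjoint x k :
  star x = x -> cnorm (x ^+ (2 ^ k)) = cnorm x ^+ (2 ^ k).
Proof.
move=> xs; elim: k => [//|k IH].
by rewrite expnSr !exprM cnorm_sqr_selfadjoint ?IH // star_exp.
Qed.

(** Stated with [cnorm] since [B] carries no topology. *)
Definition norm_cvg (u : nat -> B) (l : B) : Prop :=
  cnorm (u n - l) @[n --> \oo] --> (0 : R).

Lemma norm_cvgP (u : nat -> B) l : norm_cvg u l <->
  forall e : R, 0 < e -> \forall n \near \oo, cnorm (u n - l) < e.
Proof.
split=> [/cvgrPdist_lt h e e0|h].
  near=> n; suff: `|0 - cnorm (u n - l)| < e.
    by rewrite sub0r normrN ger0_norm ?cnorm_ge0.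
  by near: n; exact: h.
apply/cvgrPdist_lt => e e0; near=> n.
rewrite sub0r normrN ger0_norm ?cnorm_ge0 //; near: n; exact: h.
Unshelve. all: end_near. Qed.

Lemma norm_cvg_le (u : nat -> B) l (v : nat -> R) :
  v @ \oo --> (0 : R) -> (\forall n \near \oo, cnorm (u n - l) <= v n) ->
  norm_cvg u l.
Proof.
move=> v0 uv; apply: (squeeze_cvgr _ (cvg_cst 0) v0).
by near=> n; rewrite cnorm_ge0 /=; near: n.
Unshelve. all: end_near. Qed.

Lemma norm_limit_unique (u : nat -> B) l l' :
  norm_cvg u l -> norm_cvg u l' -> l = l'.
Proof.
move=> ul ul'; apply/eqP; rewrite -subr_eq0; apply/eqP/cnorm0_eq0/le_anti.
rewrite cnorm_ge0 andbT.
have h : (fun n => cnorm (u n - l) + cnorm (u n - l')) @ \oo --> (0 : R).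
  by rewrite -(addr0 0); exact: cvgD.
rewrite -(cvg_lim _ h) //; apply: limr_ge; first by apply/cvg_ex; exists 0.
near=> n; rewrite [cnorm (u n - l)]cnormBC; exact: cnorm_le_dist.
Unshelve. all: end_near. Qed.

Lemma near_norm_cvg (u v : nat -> B) l :
  (\forall n \near \oo, u n = v n) -> norm_cvg u l -> norm_cvg v l.
Proof.
move=> uv ul; apply: (norm_cvg_le ul).
by near=> n; rewrite -(near uv n).
Unshelve. all: end_near. Qed.

Lemma norm_cvg_cst l : norm_cvg (fun=> l) l.
Proof. by rewrite /norm_cvg subrr cnorm0; exact: cvg_cst. Qed.

Lemma norm_cvgD (u v : nat -> B) l m :
  norm_cvg u l -> norm_cvg v m -> norm_cvg (fun n => u n + v n) (l + m).
Proof.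
move=> ul vm.
have h : (fun n => cnorm (u n - l) + cnorm (v n - m)) @ \oo --> (0 : R).
  by rewrite -(addr0 0); exact: cvgD.
apply: (norm_cvg_le h).
by near=> n; rewrite opprD addrACA cnormD.
Unshelve. all: end_near. Qed.

Lemma norm_cvg_sum (I : Type) (r : seq I) (u : I -> nat -> B) (l : I -> B) :
  (forall i, norm_cvg (u i) (l i)) ->
  norm_cvg (fun n => \sum_(i <- r) u i n) (\sum_(i <- r) l i).
Proof.
move=> ul; elim: r => [|i r IH].
  by apply: near_norm_cvg (norm_cvg_cst _); near=> n; rewrite !big_nil.
rewrite big_cons; apply: near_norm_cvg (norm_cvgD (ul i) IH).
by near=> n; rewrite big_cons.
Unshelve. all: end_near. Qed.

Lemma norm_cvg_map (f : B -> B) (C : R) (u : nat -> B) l :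
  {morph f : x y / x - y} -> (forall x, cnorm (f x) <= C * cnorm x) ->
  norm_cvg u l -> norm_cvg (f \o u) (f l).
Proof.
move=> fB fC ul.
have h : (fun n => C * cnorm (u n - l)) @ \oo --> (0 : R).
  by rewrite -(mulr0 C); apply: cvgM => //; exact: cvg_cst.
apply: (norm_cvg_le h).
by near=> n; rewrite /= -fB.
Unshelve. all: end_near. Qed.

End Norm.

(** * Selfadjoint elements and their spectrum *)

Section Invertible.
Context (U : pzRingType).
Implicit Types x y : U.

Lemma invertibleM x y : invertible x -> invertible y -> invertible (x * y).
Proof.
move=> [x' [xx' x'x]] [y' [yy' y'y]]; exists (y' * x'); split.
  by rewrite mulrA -(mulrA x) yy' mulr1.
by rewrite mulrA -(mulrA y') x'x mulr1.
Qed.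

Lemma invertibleN x : invertible x -> invertible (- x).
Proof. by move=> [y [xy yx]]; exists (- y); rewrite !mulrNN. Qed.

Lemma comm_inverse x x' y : x * x' = 1 -> x' * x = 1 -> GRing.comm x y ->
  GRing.comm x' y.
Proof.
move=> xx' x'x xy; rewrite /GRing.comm -[LHS]mulr1 -xx' !mulrA.
by rewrite -(mulrA x' y) -xy mulrA x'x mul1r.
Qed.

End Invertible.

Section Spectrum.
Context (R : realType) (B : cstarAlgType R).
Implicit Types x y : B.

Lemma invertibleZ (c : R[i]) x : c != 0 -> invertible x -> invertible (c *: x).
Proof.
move=> c0 [y [xy yx]]; exists (c^-1 *: y).
by rewrite -!scalerAl -!scalerAr !scalerA xy yx mulfV ?mulVf // scale1r.
Qed.

Lemma invertible_neumann x : cnorm x < 1 -> invertible (1 - x).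
Proof.
set r := cnorm x => r1; have r0 : 0 <= r := cnorm_ge0 x.
pose S n : B := \sum_(k < n) x ^+ k.
have r10 : 0 < 1 - r by rewrite subr_gt0.
have tail n j : cnorm (S (n + j)%N - S n) <= (r ^+ n - r ^+ (n + j)) / (1 - r).
  elim: j => [|j IH]; first by rewrite addn0 !subrr cnorm0 mul0r.
  rewrite addnS /S big_ord_recr /= addrAC (le_trans (cnormD _ _)) //.
  rewrite (le_trans (lerD IH (cnormX_le _ _))) // -/r ler_pdivlMr // mulrDl.
  by rewrite divfK ?gt_eqF // exprSr; lra.
have tail' n j : cnorm (S (n + j)%N - S n) <= r ^+ n / (1 - r).
  rewrite (le_trans (tail n j)) // ler_pM2r ?invr_gt0 //.
  by rewrite gerBl exprn_ge0.
have pow0 (e : R) : 0 < e -> exists N : nat, r ^+ N / (1 - r) < e.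
  move=> e0; have re : 0 < e * (1 - r) by rewrite mulr_gt0.
  have : (fun n => r ^+ n) @ \oo --> (0 : R).
    by apply: cvg_expr; rewrite ger0_norm.
  move=> /cvgrPdist_lt /(_ _ re)[N _ /(_ N (leqnn _))].
  by rewrite /= sub0r normrN ger0_norm ?exprn_ge0 // => h; exists N;
    rewrite ltr_pdivrMr.
have [l Sl] : exists l, norm_cvg S l.
  apply: cnorm_complete => e e0; have [N rN] := pow0 e e0; exists N => m n Nm Nn.
  wlog nm : m n Nm Nn / (n <= m)%N.
    by move=> h; case: (leqP n m) => [|/ltnW] nm; [|rewrite cnormBC]; exact: h.
  rewrite -(subnKC nm); apply: le_lt_trans (tail' _ _) _.
  apply: le_lt_trans rN; rewrite ler_pM2r ?invr_gt0 //.
  by apply: ler_wiXn2l => //; exact: ltW.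
have S1 n : (1 - x) * S n = 1 - x ^+ n.
  by rewrite /S -[RHS]opprB subrX1 -mulNr opprB.
have S1' n : S n * (1 - x) = 1 - x ^+ n.
  rewrite -S1; apply/commr_sym/commr_sum => k _.
  exact/commrX/commr_sym/commrB/commr_refl/commr1.
have x1 : norm_cvg (fun n => 1 - x ^+ n) 1.
  have h : (fun n => r ^+ n) @ \oo --> (0 : R).
    by apply: cvg_expr; rewrite ger0_norm.
  apply: (norm_cvg_le h); near=> n.
  by rewrite addrAC subrr add0r cnormN cnormX_le.
exists l; split.
- apply: (norm_limit_unique (u := fun n => (1 - x) * S n)).
    apply: (@norm_cvg_map _ _ (fun y => (1 - x) * y) (cnorm (1 - x))) => //.
    - by move=> y z; rewrite mulrBr.
    - by move=> y; exact: cnormM.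
  by apply: near_norm_cvg x1; near=> n; rewrite S1.
- apply: (norm_limit_unique (u := fun n => S n * (1 - x))).
    apply: (@norm_cvg_map _ _ (fun y => y * (1 - x)) (cnorm (1 - x))) => //.
    - by move=> y z; rewrite mulrBl.
    - by move=> y; rewrite mulrC; exact: cnormM.
  by apply: near_norm_cvg x1; near=> n; rewrite S1'.
Unshelve. all: end_near. Qed.

(** The spectrum is contained in the disk whose radius is the norm. *)
Lemma invertible_sub_scalar x (c : R[i]) :
  cnorm x < complex.Re `|c| -> invertible (x - c%:A).
Proof.
move=> xc; have c0 : c != 0.
  by apply: contraTneq xc => ->; rewrite normr0 /= -leNgt cnorm_ge0.
have -> : x - c%:A = - (c *: (1 - c^-1 *: x)).
  by rewrite scalerBr scalerA mulfV // scale1r opprB.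
apply/invertibleN/invertibleZ => //; apply: invertible_neumann.
have nc : `|c| = (complex.Re `|c|)%:C%C by rewrite normc_def.
rewrite cnormZ normfV nc -fmorphV /= mulrC ltr_pdivrMr ?mul1r //.
exact: le_lt_trans (cnorm_ge0 x) xc.
Qed.

Lemma conj_i : ('i : R[i])^* = - 'i.
Proof. exact: conjCi. Qed.

(** Arens' trick: adding [i mu] to [y] increases the square of its norm by at
    most [mu^2], but its distance to the scalar to be avoided from [1] to
    [1 + mu]; for large [mu] the latter wins. *)
Lemma invertible_sub_i y : star y = y -> invertible (y - 'i%:A).
Proof.
move=> ys; have [mu mu0 muE] : exists2 mu : R, 0 <= mu & cnorm y ^+ 2 = mu.
  by exists (cnorm y ^+ 2); rewrite ?exprn_ge0 ?cnorm_ge0.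
(* Any [mu] with |y|^2 + mu^2 < (1 + mu)^2 works. *)
pose z : B := y + ('i * mu%:C%C) *: 1.
have -> : y - 'i%:A = z - ('i * (1 + mu)%:C%C)%:A.
  have -> : (1 + mu)%:C%C = 1 + mu%:C%C :> R[i] by rewrite rmorphD.
  by rewrite /z mulrDr mulr1 scalerDl opprD addrACA subrr addr0.
apply: invertible_sub_scalar.
rewrite normrM normCi mul1r Re_norm_real ger0_norm ?addr_ge0 //.
rewrite -(ltr_pXn2r (n := 2)) ?nnegrE ?addr_ge0 ?cnorm_ge0 // -cnorm_star.
have -> : star z * z = y ^+ 2 + (mu ^+ 2)%:C%C *: 1.
  rewrite /z starD starZ star1 ys rmorphM /= conj_i.
  have -> : (mu%:C%C)^* = mu%:C%C by apply/conj_Creal; rewrite complex_real.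
  rewrite mulrDl !mulrDr -!scalerAl -!scalerAr !mulr1 !mul1r scalerA.
  rewrite addrA -(addrA (y * y)) mulNr scaleNr subrr addr0.
  congr (_ + _ *: _); rewrite mulNr mulrACA -expr2 sqrCi mulN1r opprK.
  by rewrite expr2 rmorphM.
rewrite (le_lt_trans (cnormD _ _)) // cnorm_rscale cnorm1 mulr1.
rewrite ger0_norm ?exprn_ge0 // (le_lt_trans (lerD (cnormX_le _ _) (lexx _))) //.
by rewrite muE; nra.
Qed.

Lemma invertible_1_add_sqr y : star y = y -> invertible (1 + y ^+ 2).
Proof.
move=> ys.
have -> : 1 + y ^+ 2 = (y - 'i%:A) * (- (- y - 'i%:A)).
  rewrite opprD !opprK mulrDr !mulrBl mulr_algr !mulr_algl addrA subrK scalerA.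
  by rewrite -!expr2 sqrCi scaleN1r opprK addrC.
apply: invertibleM; first exact: invertible_sub_i.
by apply/invertibleN/invertible_sub_i; rewrite starN ys.
Qed.

(** On a real spectrum this is the bound [2t <= 1 + t^2].  The Cayley transform
    [(1 - iy)^2 h] is unitary, so has norm 1, and its imaginary part is
    [- 2 y h]. *)
Lemma cnorm_cayley_im y h : star y = y ->
  (1 + y ^+ 2) * h = 1 -> h * (1 + y ^+ 2) = 1 -> cnorm (y * h) <= 2^-1.
Proof.
move=> ys wh hw; set w := 1 + y ^+ 2 in wh hw.
have ws : star w = w by rewrite /w starD star1 expr2 starM ys.
have hs : star h = h.
  by rewrite -[LHS]mulr1 -wh mulrA -{1}ws -starM wh star1 mul1r.
pose j := 'i *: y.
have js : star j = - j by rewrite starZ conj_i ys scaleNr.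
have j2 : j * j = - y ^+ 2.
  by rewrite /j -scalerAl -scalerAr scalerA -expr2 sqrCi scaleN1r expr2.
pose p := 1 + j; pose q := 1 - j.
have ps : star p = q by rewrite starD star1 js.
have qs : star q = p by rewrite starB star1 js opprK.
have pq : p * q = w by rewrite /p /q mulrBr !mulrDl !mul1r !mulr1 j2 addrKA opprK.
have qp : q * p = w by rewrite /p /q mulrDr !mulrBl !mul1r !mulr1 j2 addrA subrK opprK.
have wy : GRing.comm w y by apply/commr_sym/commrD; [exact: commr1|exact/commrX].
have hy : GRing.comm h y := comm_inverse wh hw wy.
have hp : GRing.comm h p.
  by apply: commrD; [exact: commr1|rewrite /GRing.comm /j -scalerAr hy scalerAl].
have c1 : cnorm (q * q * h) = 1.
  have e : star (q * q * h) * (q * q * h) = 1.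
    rewrite !starM hs qs !mulrA -(mulrA (h * p)) pq -(mulrA h p) -qp.
    by rewrite (mulrA p q p) pq mulrA hw mul1r pq wh.
  apply/eqP; rewrite -(@eqrXn2 _ 2) ?cnorm_ge0 //.
  by rewrite -cnorm_star e cnorm1 expr1n.
have e4 : star (q * q * h) - q * q * h = (4 * 'i) *: (y * h).
  rewrite !starM hs qs mulrA hp -(mulrA p) hp mulrA -mulrBl.
  have -> : p * p - q * q = 4 *: j.
    have pBq : p - q = j *+ 2 by rewrite /p /q opprB addrC addrA subrK.
    rewrite -(subrK (q * p) (p * p)) -mulrBl -addrA -mulrBr pBq.
    rewrite mulrnAl mulrnAr -mulrnDl mulrDr mulrBl mul1r mulr1 addrACA subrr.
    by rewrite addr0 -mulr2n -mulrnA scaler_nat.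
  by rewrite /j scalerA -scalerAl.
have : cnorm ((4 * 'i) *: (y * h)) <= 2.
  by rewrite -e4 (le_trans (cnormB_le _ _)) // cnorm_starE c1.
rewrite cnormZ normrM normCi mulr1.
have -> : (4 : R[i]) = (4 : R)%:C%C by rewrite rmorph_nat.
rewrite Re_norm_real ger0_norm //; lra.
Qed.

End Spectrum.

(** * The cone of positive elements *)

Section Positive.
Context (R : realType) (B : cstarAlgType R).
Implicit Types x y : B.

(** A selfadjoint element of norm 1 has [1] or [-1] in its spectrum.  If not,
    put [u_k = y^(2^(k+1))], of norm 1 by the C*-identity, and
    [f_k = u_k / (1 - u_k)].  Then [f_(k+1) = f_k u_k / (1 + u_k)], where the
    last factor has norm at most 1/2 by the Cayley bound.  So [f_k] tends to 0,
    and so does [u_k = f_k (1 - u_k)], a contradiction. *)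
Lemma not_invertible_1_sub_sqr y :
  star y = y -> cnorm y = 1 -> ~ invertible (1 - y ^+ 2).
Proof.
move=> ys y1 [g0 [g0r g0l]].
have step (z g : B) : star z = z -> cnorm z <= 1 ->
    (1 - z ^+ 2) * g = 1 -> g * (1 - z ^+ 2) = 1 ->
    exists g', [/\ (1 - (z ^+ 2) ^+ 2) * g' = 1, g' * (1 - (z ^+ 2) ^+ 2) = 1
      & cnorm ((z ^+ 2) ^+ 2 * g') <= cnorm (z ^+ 2 * g) / 2].
  move=> zs z1 gr gl; have [h [hr hl]] := invertible_1_add_sqr zs.
  have zh := cnorm_cayley_im zs hr hl.
  have gz : GRing.comm g (z ^+ 2).
    apply: (comm_inverse gr gl).
    exact/commr_sym/commrB/commr_refl/commr1.
  have [u uE] : exists u, u = z ^+ 2 by exists (z ^+ 2).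
  rewrite -uE in gr gl hr hl gz *.
  have f1 : 1 - u ^+ 2 = (1 + u) * (1 - u).
    by rewrite mulrBr mulr1 mulrDl mul1r -expr2 addrKA.
  exists (g * h); split.
  - by rewrite f1 mulrA -(mulrA (1 + u)) gr mulr1.
  - by rewrite f1 mulrA -(mulrA g) hl mulr1.
  have -> : u ^+ 2 * (g * h) = u * g * (u * h).
    by rewrite expr2 -!mulrA; congr (_ * _); rewrite !mulrA gz.
  rewrite (le_trans (cnormM _ _)) // ler_wpM2l ?cnorm_ge0 //.
  rewrite uE expr2 -mulrA (le_trans (cnormM _ _)) //.
  by have := cnorm_ge0 (z * h); have := cnorm_ge0 z; nra.
pose f0 := cnorm (y ^+ 2 * g0).
have iter k : exists g, [/\ (1 - (y ^+ (2 ^ k)) ^+ 2) * g = 1,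
    g * (1 - (y ^+ (2 ^ k)) ^+ 2) = 1
    & cnorm ((y ^+ (2 ^ k)) ^+ 2 * g) <= f0 / 2 ^+ k].
  elim: k => [|k [g [gr gl gf]]].
    by exists g0; rewrite expn0 expr1; split=> //; rewrite expr0 divr1.
  have nk : cnorm (y ^+ (2 ^ k)) <= 1.
    by rewrite cnorm_pow2_selfadjoint // y1 expr1n.
  have [g' [g'r g'l g'f]] := step _ _ (star_exp _ ys) nk gr gl.
  exists g'; rewrite expnSr exprM; split=> //.
  by rewrite (le_trans g'f) // [2 ^+ k.+1]exprSr invfM mulrA ler_pM2r ?invr_gt0.
have lek k : 2 ^+ k <= 2 * f0.
  have [g [gr gl gf]] := iter k; set u := (y ^+ (2 ^ k)) ^+ 2 in gr gl gf.
  have nu : cnorm u = 1.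
    by rewrite cnorm_sqr_selfadjoint ?star_exp // cnorm_pow2_selfadjoint // y1
      !expr1n.
  have : cnorm u <= cnorm (u * g) * cnorm (1 - u).
    have {1}-> : u = u * g * (1 - u) by rewrite -mulrA gl mulr1.
    exact: cnormM.
  have u2 : cnorm (1 - u) <= 2.
    by rewrite (le_trans (cnormB_le _ _)) // cnorm1 nu.
  rewrite nu => le1.
  have : 1 <= f0 / 2 ^+ k * 2.
    apply: le_trans le1 _; apply: ler_pM; rewrite ?cnorm_ge0 //.
  by rewrite mulrAC ler_pdivlMr ?exprn_gt0 // mul1r mulrC.
have f00 : 0 <= 2 * f0 by rewrite mulr_ge0 ?cnorm_ge0.
have := archi_boundP f00; set k := Num.bound _ => kf.
have := lek k; rewrite leNgt => /negP[]; apply: (lt_le_trans kf).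
by rewrite -natrX ler_nat ltnW // ltn_expl.
Qed.

(** The converse of [positive_of_cnorm].  If [N = |t - x| > t], then
    [y = (t - x) / N] has norm 1, but [1 - y] is proportional to
    [x + (N - t)], invertible as [x] is positive, and [1 + y] to
    [(N + t) - x], invertible as [N + t > |x|]. *)
Lemma positive_cnorm_le x (t : R) :
  positive x -> cnorm x <= t -> cnorm (t%:C%C%:A - x) <= t.
Proof.
move=> [xs xpos] xt; rewrite leNgt; apply/negP; set N := cnorm _ => tN.
have t0 : 0 <= t := le_trans (cnorm_ge0 x) xt.
have N0 : 0 < N := le_lt_trans t0 tN.
have NC0 : N^-1%:C%C != 0 :> R[i] by rewrite fmorph_eq0 gt_eqF ?invr_gt0.
pose y := N^-1%:C%C *: (t%:C%C%:A - x).
have NN : N^-1%:C%C * N%:C%C = 1 :> R[i].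
  by rewrite -rmorphM /= mulVf ?rmorph1 // gt_eqF.
have ys : star y = y by rewrite star_rscale starB star_rscale star1 xs.
apply: (@not_invertible_1_sub_sqr y ys).
  by rewrite cnorm_rscale ger0_norm ?invr_ge0 ?ltW // -/N mulVf ?gt_eqF.
have -> : 1 - y ^+ 2 = (1 - y) * (1 + y).
  by rewrite mulrDr mulr1 mulrBl mul1r -expr2 addrA subrK.
have one : (1 : B) = N^-1%:C%C *: (N%:C%C%:A) by rewrite scalerA NN scale1r.
have scE (r s : R) : (r + s)%:C%C = r%:C%C + s%:C%C :> R[i] by rewrite rmorphD.
have scNE (r : R) : (- r)%:C%C = - r%:C%C :> R[i] by rewrite rmorphN.
apply: invertibleM.
- have -> : 1 - y = N^-1%:C%C *: (x - (t - N)%:C%C%:A).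
    rewrite /y {1}one -scalerBr scE scNE scalerBl; congr (_ *: _).
    by rewrite !opprB addrCA addrA addrAC.
  apply: invertibleZ => //; apply: contrapT => /(xpos _) /=.
  by rewrite ler0c subr_ge0 leNgt tN.
- have -> : 1 + y = N^-1%:C%C *: - (x - (N + t)%:C%C%:A).
    by rewrite /y {1}one -scalerDr scE scalerDl opprB addrA.
  apply/invertibleZ/invertibleN/invertible_sub_scalar => //.
  rewrite Re_norm_real ger0_norm; last exact: addr_ge0 (ltW N0) t0.
  by rewrite (le_lt_trans xt) // ltrDr.
Qed.

(** The spectrum of [x] is real by [invertible_sub_i], and a negative [l] in it
    would put [t - l > t] in the spectrum of [t - x]. *)
Lemma positive_of_cnorm x (t : R) :
  star x = x -> cnorm (t%:C%C%:A - x) <= t -> positive x.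
Proof.
move=> xs xt; split=> // l /= nl.
have t0 : 0 <= t := le_trans (cnorm_ge0 _) xt.
have [a [b lE]] : exists a b : R, l = a%:C%C + 'i * b%:C%C.
  have /complex_realP[a aE] := Creal_Re l; have /complex_realP[b bE] := Creal_Im l.
  by exists a, b; rewrite -aE -bE -Crect.
have b0 : b = 0.
  apply: contrapT => /eqP b0; apply: nl.
  have bC : b%:C%C != 0 :> R[i] by rewrite fmorph_eq0.
  have bb : b%:C%C * b^-1%:C%C = 1 :> R[i].
    by rewrite -rmorphM /= mulfV ?rmorph1.
  have -> : x - l%:A = b%:C%C *: (b^-1%:C%C *: (x - a%:C%C%:A) - 'i%:A).
    rewrite scalerBr scalerA bb scale1r lE scalerDl opprD addrA.
    by rewrite scalerA mulrC.
  apply: invertibleZ => //; apply: invertible_sub_i.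
  by rewrite star_rscale starB star_rscale star1 xs.
have {b b0}lE : l = a%:C%C by rewrite lE b0 rmorph0 mulr0 addr0.
rewrite lE ler0c leNgt; apply/negP => a0; apply: nl; rewrite lE.
have -> : x - a%:C%C%:A = - (t%:C%C%:A - x - (t - a)%:C%C%:A).
  have -> : (t - a)%:C%C = t%:C%C - a%:C%C :> R[i] by rewrite rmorphB.
  by rewrite scalerBl !opprB [RHS]addrC addrA subrK.
apply/invertibleN/invertible_sub_scalar.
rewrite Re_norm_real ger0_norm; lra.
Qed.

Lemma positive0 : positive (0 : B).
Proof. by apply: (@positive_of_cnorm _ 0); rewrite ?star0 // subr0 scale0r cnorm0. Qed.

Lemma positiveD x y : positive x -> positive y -> positive (x + y).
Proof.
move=> px py; apply: (@positive_of_cnorm _ (cnorm x + cnorm y)).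
  by rewrite starD (proj1 px) (proj1 py).
have -> : (cnorm x + cnorm y)%:C%C = (cnorm x)%:C%C + (cnorm y)%:C%C :> R[i].
  by rewrite rmorphD.
rewrite scalerDl opprD addrACA (le_trans (cnormD _ _)) //.
by rewrite lerD // positive_cnorm_le.
Qed.

Lemma positive_sum (I : Type) (r : seq I) (P : pred I) (F : I -> B) :
  (forall i, positive (F i)) -> positive (\sum_(i <- r | P i) F i).
Proof. by move=> pF; elim/big_ind: _ => *; [exact: positive0|exact: positiveD|]. Qed.

Lemma positiveZ (r : R) x : 0 <= r -> positive x -> positive (r%:C%C *: x).
Proof.
move=> r0 px; apply: (@positive_of_cnorm _ (r * cnorm x)).
  by rewrite star_rscale (proj1 px).
have -> : (r * cnorm x)%:C%C = r%:C%C * (cnorm x)%:C%C :> R[i].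
  by rewrite rmorphM.
rewrite -scalerA -scalerBr cnorm_rscale ger0_norm // ler_wpM2l //.
exact: positive_cnorm_le.
Qed.

Lemma positive_norm_limit (u : nat -> B) l :
  (\forall n \near \oo, positive (u n)) -> norm_cvg u l -> positive l.
Proof.
move=> pu ul; have ulP := (norm_cvgP u l).1 ul.
apply: (@positive_of_cnorm _ (cnorm l + 1)).
- apply: (norm_limit_unique (u := star \o u)).
    apply: (@norm_cvg_map _ _ _ 1) => // [x y|x]; first exact: starB.
    by rewrite mul1r cnorm_starE.
  by apply: near_norm_cvg ul; near=> n; rewrite /= (proj1 (near pu n _)).
- apply/ler_addgt0Pr => e e0.
  have e1 : 0 < Num.min e 1 by rewrite lt_min e0 ltr01.
  near \oo => n.
  have un : cnorm (u n - l) < Num.min e 1 by near: n; exact: ulP.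
  rewrite lt_min in un; case/andP: un => une un1.
  have le_un : cnorm (u n) <= cnorm l + 1.
    rewrite -(subrK l (u n)) addrC (le_trans (cnormD _ _)) // lerD2l.
    exact: ltW.
  have := positive_cnorm_le (near pu n _) le_un.
  have := cnorm_le_dist ((cnorm l + 1)%:C%C%:A) (u n) l => h1 /(_ _) h2.
  by apply: le_trans h1 _; apply: lerD; [apply: h2|exact: ltW].
Unshelve. all: end_near. Qed.

End Positive.

(** * Matrices as a B-valued probability space *)

(** An alias of the matrix type, as the canonical scaling on matrices over [A]
    is by elements of [A]; the dimension is positive to have a nonzero ring. *)
Definition mxspace (R : realType) (B : cstarAlgType R) (A : bprobSpace B)
  (n : nat) : Type := 'M[A]_n.+1.

Section MatrixSpace.
Context (R : realType) (B : cstarAlgType R) (A : bprobSpace B) (n : nat).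
Local Notation M := (mxspace A n).

HB.instance Definition _ := GRing.NzRing.copy M 'M[A]_n.+1.

Definition mxspace_scale (c : R[i]) (x : M) : M := map_mx (fun a => c *: a) x.

Lemma mxspace_scalerA c d x :
  mxspace_scale c (mxspace_scale d x) = mxspace_scale (c * d) x.
Proof. by apply/matrixP => i j; rewrite !mxE scalerA. Qed.

Lemma mxspace_scale1r : left_id 1 mxspace_scale.
Proof. by move=> x; apply/matrixP => i j; rewrite !mxE scale1r. Qed.

Lemma mxspace_scalerDr : right_distributive mxspace_scale +%R.
Proof. by move=> c x y; apply/matrixP => i j; rewrite !mxE scalerDr. Qed.

Lemma mxspace_scalerDl x : {morph mxspace_scale^~ x : c d / c + d}.
Proof. by move=> c d; apply/matrixP => i j; rewrite !mxE scalerDl. Qed.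

HB.instance Definition _ := GRing.Zmodule_isLmodule.Build R[i] M
  mxspace_scalerA mxspace_scale1r mxspace_scalerDr mxspace_scalerDl.

Lemma mxspace_scalerAl (c : R[i]) (x y : M) : c *: (x * y) = c *: x * y.
Proof.
apply/matrixP => i j; rewrite !mxE scaler_sumr.
by apply: eq_bigr => k _; rewrite mxE scalerAl.
Qed.

HB.instance Definition _ := GRing.Lmodule_isLalgebra.Build R[i] M
  mxspace_scalerAl.

Lemma mxspace_scalerAr (c : R[i]) (x y : M) : c *: (x * y) = x * (c *: y).
Proof.
apply/matrixP => i j; rewrite !mxE scaler_sumr.
by apply: eq_bigr => k _; rewrite mxE scalerAr.
Qed.

HB.instance Definition _ := GRing.Lalgebra_isAlgebra.Build R[i] M
  mxspace_scalerAr.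

Definition mxspace_star (x : M) : M := @mxstar R A n.+1 x.

Lemma mxspace_starK : involutive mxspace_star.
Proof. by move=> x; apply/matrixP => i j; rewrite !mxE starK. Qed.

Lemma mxspace_starD : {morph mxspace_star : x y / x + y}.
Proof. by move=> x y; apply/matrixP => i j; rewrite !mxE starD. Qed.

Lemma mxspace_starM (x y : M) :
  mxspace_star (x * y) = mxspace_star y * mxspace_star x.
Proof.
apply/matrixP => i j; rewrite !mxE star_sum.
by apply: eq_bigr => k _; rewrite !mxE starM.
Qed.

Lemma mxspace_starZ (c : R[i]) (x : M) :
  mxspace_star (c *: x) = c^* *: mxspace_star x.
Proof. by apply/matrixP => i j; rewrite !mxE starZ. Qed.

HB.instance Definition _ := isStarAlgebra.Build R M
  mxspace_starK mxspace_starD mxspace_starM mxspace_starZ.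

Definition mxspace_inj (b : B) : M := (binj A b)%:M.

Lemma mxspace_inj_linear : linear mxspace_inj.
Proof.
move=> c x y; apply/matrixP => i j; rewrite !mxE linearP.
by case: eqP => _; rewrite ?mulr1n ?mulr0n ?scaler0 ?addr0.
Qed.

Lemma mxspace_inj_monoid : GRing.monoid_morphism mxspace_inj.
Proof.
split; first by rewrite /mxspace_inj rmorph1.
by move=> x y; rewrite /mxspace_inj rmorphM scalar_mxM.
Qed.

HB.instance Definition _ := GRing.isLinear.Build R[i] B M *:%R mxspace_inj
  mxspace_inj_linear.
HB.instance Definition _ := GRing.isMonoidMorphism.Build B M mxspace_inj
  mxspace_inj_monoid.

Definition mxspace_exp (x : M) : B := @mx_bexp R B A n.+1 x.

Lemma mxspace_exp_linear : linear mxspace_exp.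
Proof.
move=> c x y; rewrite /mxspace_exp /mx_bexp scalerA mulrC -scalerA -scalerDr.
congr (_ *: _); rewrite scaler_sumr -big_split; apply: eq_bigr => i _ /=.
by rewrite !mxE linearP.
Qed.

HB.instance Definition _ := GRing.isLinear.Build R[i] M B *:%R mxspace_exp
  mxspace_exp_linear.

Lemma mxspace_inj_star b : mxspace_inj (star b) = star (mxspace_inj b).
Proof.
apply/matrixP => i j; rewrite !mxE binj_star eq_sym.
by case: eqP => _; rewrite ?mulr1n ?mulr0n ?star0.
Qed.

Lemma mxspace_exp_bimod b1 x b2 :
  mxspace_exp (mxspace_inj b1 * x * mxspace_inj b2) = b1 * mxspace_exp x * b2.
Proof.
rewrite /mxspace_exp /mx_bexp -scalerAr -scalerAl; congr (_ *: _).
rewrite mulr_sumr mulr_suml; apply: eq_bigr => i _.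
rewrite -bexp_bimod; congr (bexp _ _).
have -> : mxspace_inj b1 * x * mxspace_inj b2 =
    (binj A b1)%:M *m x *m (binj A b2)%:M by [].
rewrite mul_scalar_mx mxE (bigD1 i) //= big1 ?addr0 => [|k ki].
  by rewrite !mxE eqxx.
by rewrite !mxE (negPf ki) mulr0n mulr0.
Qed.

Lemma mxspace_exp_inj b : mxspace_exp (mxspace_inj b) = b.
Proof.
rewrite /mxspace_exp /mx_bexp (eq_bigr (fun=> b)) => [|i _].
  by rewrite sumr_const card_ord -[b *+ _](@scaler_nat R[i]) scalerA mulVf ?scale1r.

by rewrite mxE eqxx mulr1n bexp_binj.
Qed.

Lemma mxspace_exp_pos x : positive (mxspace_exp (x * star x)).
Proof.
rewrite /mxspace_exp /mx_bexp.
have -> : n.+1%:R^-1 = (n.+1%:R^-1)%:C%C :> R[i].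
  by rewrite fmorphV rmorph_nat.
apply: positiveZ.
  by rewrite invr_ge0.
apply: positive_sum => i; rewrite mxE linear_sum; apply: positive_sum => k.
by rewrite !mxE; exact: bexp_pos.
Qed.

Definition mx_bprobSpace : bprobSpace B :=
  @BProbSpace R B M mxspace_inj mxspace_exp
    mxspace_inj_star mxspace_exp_bimod mxspace_exp_inj mxspace_exp_pos.

End MatrixSpace.

(** * Limits of B-valued probability spaces *)

Section SequenceAlgebra.
Context (R : realType) (B : cstarAlgType R) (A : nat -> bprobSpace B).
Context (I : Type) (x : forall n, I -> A n).

Definition poly_seq (p : bpoly B I) (n : nat) : A n :=
  beval (binj (A n)) star (x n) p.

Definition is_poly_seq (u : forall n, A n) : Prop :=
  exists p, forall n, u n = poly_seq p n.

(** Only sequences given by a single polynomial are kept: these are the ones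
    along which the expectations are known to converge. *)
Definition seq_algebra : Type := {u : forall n, A n | is_poly_seq u}.

HB.instance Definition _ := gen_eqMixin seq_algebra.
HB.instance Definition _ := gen_choiceMixin seq_algebra.

Definition seq_of (u : seq_algebra) : forall n, A n := proj1_sig u.

Lemma seq_algebraP (u v : seq_algebra) :
  (forall n, seq_of u n = seq_of v n) -> u = v.
Proof.
case: u v => u up [v vp] /= uv; have e : u = v by exact: functional_extensionality_dep.
by case: _ / e vp => vp; rewrite (Prop_irrelevance up vp).
Qed.

Lemma is_poly_seq_const b : is_poly_seq (fun n => binj (A n) b).
Proof. by exists (BConst b). Qed.

Lemma is_poly_seq_var i : is_poly_seq (fun n => x n i).
Proof. by exists (BVar i). Qed.

Lemma is_poly_seqD u v : is_poly_seq u -> is_poly_seq v ->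
  is_poly_seq (fun n => u n + v n).
Proof. by move=> [p up] [q vq]; exists (BAdd p q) => n; rewrite up vq. Qed.

Lemma is_poly_seqM u v : is_poly_seq u -> is_poly_seq v ->
  is_poly_seq (fun n => u n * v n).
Proof. by move=> [p up] [q vq]; exists (BMul p q) => n; rewrite up vq. Qed.

Lemma is_poly_seqZ c u : is_poly_seq u -> is_poly_seq (fun n => c *: u n).
Proof.
move=> [p up]; exists (BMul (BConst c%:A) p) => n.
by rewrite up /poly_seq /= linearZ rmorph1 mulr_algl.
Qed.

Fixpoint bpoly_star (p : bpoly B I) : bpoly B I :=
  match p with
  | BConst b => BConst (star b)
  | BVar i => BVarStar i
  | BVarStar i => BVar i
  | BAdd p q => BAdd (bpoly_star p) (bpoly_star q)
  | BMul p q => BMul (bpoly_star q) (bpoly_star p)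
  end.

Lemma poly_seq_star p n : star (poly_seq p n) = poly_seq (bpoly_star p) n.
Proof.
rewrite /poly_seq; elim: p => //= [b|i|p IHp q IHq|p IHp q IHq].
- by rewrite binj_star.
- by rewrite starK.
- by rewrite starD IHp IHq.
- by rewrite starM IHp IHq.
Qed.

Lemma is_poly_seq_star u : is_poly_seq u -> is_poly_seq (fun n => star (u n)).
Proof. by move=> [p up]; exists (bpoly_star p) => n; rewrite up poly_seq_star. Qed.

Definition seq_const b : seq_algebra :=
  exist is_poly_seq _ (is_poly_seq_const b).
Definition seq_var i : seq_algebra :=
  exist is_poly_seq _ (is_poly_seq_var i).
Definition seq_add (u v : seq_algebra) : seq_algebra :=
  exist is_poly_seq _ (is_poly_seqD (proj2_sig u) (proj2_sig v)).
Definition seq_mul (u v : seq_algebra) : seq_algebra :=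
  exist is_poly_seq _ (is_poly_seqM (proj2_sig u) (proj2_sig v)).
Definition seq_scale c (u : seq_algebra) : seq_algebra :=
  exist is_poly_seq _ (is_poly_seqZ c (proj2_sig u)).
Definition seq_star (u : seq_algebra) : seq_algebra :=
  exist is_poly_seq _ (is_poly_seq_star (proj2_sig u)).

Fact seq_addA : associative seq_add.
Proof. by move=> u v w; apply: seq_algebraP => n /=; rewrite addrA. Qed.
Fact seq_addC : commutative seq_add.
Proof. by move=> u v; apply: seq_algebraP => n /=; rewrite addrC. Qed.
Fact seq_add0 : left_id (seq_const 0) seq_add.
Proof. by move=> u; apply: seq_algebraP => n /=; rewrite rmorph0 add0r. Qed.
Fact seq_addN : left_inverse (seq_const 0) (seq_scale (- 1)) seq_add.
Proof.
by move=> u; apply: seq_algebraP => n /=; rewrite rmorph0 scaleN1r addNr.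
Qed.
HB.instance Definition _ := GRing.isZmodule.Build seq_algebra
  seq_addA seq_addC seq_add0 seq_addN.

Fact seq_mulA : associative seq_mul.
Proof. by move=> u v w; apply: seq_algebraP => n /=; rewrite mulrA. Qed.
Fact seq_mul1l : left_id (seq_const 1) seq_mul.
Proof. by move=> u; apply: seq_algebraP => n /=; rewrite rmorph1 mul1r. Qed.
Fact seq_mul1r : right_id (seq_const 1) seq_mul.
Proof. by move=> u; apply: seq_algebraP => n /=; rewrite rmorph1 mulr1. Qed.
Fact seq_mulDl : left_distributive seq_mul seq_add.
Proof. by move=> u v w; apply: seq_algebraP => n /=; rewrite mulrDl. Qed.
Fact seq_mulDr : right_distributive seq_mul seq_add.
Proof. by move=> u v w; apply: seq_algebraP => n /=; rewrite mulrDr. Qed.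
Fact seq_oner_neq0 : seq_const 1 != 0.
Proof.
apply/eqP => /(congr1 (fun u => seq_of u 0%N)) /=.
by rewrite rmorph1 rmorph0 => /eqP; rewrite oner_eq0.
Qed.
HB.instance Definition _ := GRing.Zmodule_isNzRing.Build seq_algebra
  seq_mulA seq_mul1l seq_mul1r seq_mulDl seq_mulDr seq_oner_neq0.

Fact seq_scalerA c d u : seq_scale c (seq_scale d u) = seq_scale (c * d) u.
Proof. by apply: seq_algebraP => n /=; rewrite scalerA. Qed.
Fact seq_scale1r : left_id 1 seq_scale.
Proof. by move=> u; apply: seq_algebraP => n /=; rewrite scale1r. Qed.
Fact seq_scalerDr : right_distributive seq_scale +%R.
Proof. by move=> c u v; apply: seq_algebraP => n /=; rewrite scalerDr. Qed.
Fact seq_scalerDl u : {morph seq_scale^~ u : c d / c + d}.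
Proof. by move=> c d; apply: seq_algebraP => n /=; rewrite scalerDl. Qed.
HB.instance Definition _ := GRing.Zmodule_isLmodule.Build R[i] seq_algebra
  seq_scalerA seq_scale1r seq_scalerDr seq_scalerDl.

Fact seq_scalerAl (c : R[i]) (u v : seq_algebra) : c *: (u * v) = c *: u * v.
Proof. by apply: seq_algebraP => n /=; rewrite scalerAl. Qed.
HB.instance Definition _ := GRing.Lmodule_isLalgebra.Build R[i] seq_algebra
  seq_scalerAl.
Fact seq_scalerAr (c : R[i]) (u v : seq_algebra) : c *: (u * v) = u * (c *: v).
Proof. by apply: seq_algebraP => n /=; rewrite scalerAr. Qed.
HB.instance Definition _ := GRing.Lalgebra_isAlgebra.Build R[i] seq_algebra
  seq_scalerAr.

Fact seq_starK : involutive seq_star.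
Proof. by move=> u; apply: seq_algebraP => n /=; rewrite starK. Qed.
Fact seq_starD : {morph seq_star : u v / u + v}.
Proof. by move=> u v; apply: seq_algebraP => n /=; rewrite starD. Qed.
Fact seq_starM (u v : seq_algebra) : seq_star (u * v) = seq_star v * seq_star u.
Proof. by apply: seq_algebraP => n /=; rewrite starM. Qed.
Fact seq_starZ (c : R[i]) (u : seq_algebra) :
  seq_star (c *: u) = c^* *: seq_star u.
Proof. by apply: seq_algebraP => n /=; rewrite starZ. Qed.
HB.instance Definition _ := isStarAlgebra.Build R seq_algebra
  seq_starK seq_starD seq_starM seq_starZ.

Fact seq_const_linear : linear seq_const.
Proof. by move=> c b d; apply: seq_algebraP => n /=; rewrite linearP. Qed.
Fact seq_const_monoid : GRing.monoid_morphism seq_const.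
Proof. by split=> // b d; apply: seq_algebraP => n /=; rewrite rmorphM. Qed.
HB.instance Definition _ := GRing.isLinear.Build R[i] B seq_algebra *:%R
  seq_const seq_const_linear.
HB.instance Definition _ := GRing.isMonoidMorphism.Build B seq_algebra
  seq_const seq_const_monoid.

Lemma seq_const_star b : seq_const (star b) = star (seq_const b).
Proof. by apply: seq_algebraP => n /=; rewrite binj_star. Qed.

Lemma seq_of_beval p n :
  seq_of (beval seq_const star seq_var p) n = poly_seq p n.
Proof.
elim: p => //= p IHp q IHq.
- by rewrite -[LHS]/(seq_of _ n + seq_of _ n) IHp IHq.
- by rewrite -[LHS]/(seq_of _ n * seq_of _ n) IHp IHq.
Qed.

Variable mu : bpoly B I -> B.
Hypothesis mu_lim : weak_cvg (fun n => law (x n)) mu.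

Definition seq_exp (u : seq_algebra) : B :=
  xget 0 [set l | norm_cvg (fun n => bexp (A n) (seq_of u n)) l].

Lemma seq_exp_cvg u : norm_cvg (fun n => bexp (A n) (seq_of u n)) (seq_exp u).
Proof.
rewrite /seq_exp; case: xgetP => // none.
have [p up] := proj2_sig u; case: (none (mu p)).
by apply: near_norm_cvg (mu_lim p); near=> n; rewrite /law [seq_of _ _]up.
Unshelve. all: end_near. Qed.

Lemma seq_exp_lim u l :
  norm_cvg (fun n => bexp (A n) (seq_of u n)) l -> seq_exp u = l.
Proof. exact: (norm_limit_unique (seq_exp_cvg u)). Qed.

Fact seq_exp_linear : linear seq_exp.
Proof.
move=> c u v; apply: seq_exp_lim.
have fB : {morph (fun b : B => c *: b) : b d / b - d}.
  by move=> b d /=; rewrite scalerBr.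
have fC (b : B) : cnorm (c *: b) <= complex.Re `|c| * cnorm b by rewrite cnormZ.
have h := norm_cvgD (norm_cvg_map fB fC (seq_exp_cvg u)) (seq_exp_cvg v).
by apply: near_norm_cvg h; near=> n; rewrite /= linearP.
Unshelve. all: end_near. Qed.
HB.instance Definition _ := GRing.isLinear.Build R[i] seq_algebra B *:%R
  seq_exp seq_exp_linear.

Lemma seq_exp_bimod b1 u b2 :
  seq_exp (seq_const b1 * u * seq_const b2) = b1 * seq_exp u * b2.
Proof.
apply: seq_exp_lim.
have fB : {morph (fun b => b1 * b * b2) : b d / b - d}.
  by move=> b d /=; rewrite mulrBr mulrBl.
have fC b : cnorm (b1 * b * b2) <= cnorm b1 * cnorm b2 * cnorm b.
  rewrite (le_trans (cnormM _ _)) // mulrAC ler_wpM2r ?cnorm_ge0 //.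
  exact: cnormM.
have h := norm_cvg_map fB fC (seq_exp_cvg u).
by apply: near_norm_cvg h; near=> n; rewrite /= bexp_bimod.
Unshelve. all: end_near. Qed.

Lemma seq_exp_const b : seq_exp (seq_const b) = b.
Proof.
apply: seq_exp_lim; apply: near_norm_cvg (norm_cvg_cst b).
by near=> n; rewrite /= bexp_binj.
Unshelve. all: end_near. Qed.

Lemma seq_exp_pos u : positive (seq_exp (u * star u)).
Proof.
apply: positive_norm_limit (seq_exp_cvg _).
by near=> n; exact: bexp_pos.
Unshelve. all: end_near. Qed.

Definition seq_bprobSpace : bprobSpace B :=
  @BProbSpace R B seq_algebra seq_const seq_exp
    seq_const_star seq_exp_bimod seq_exp_const seq_exp_pos.

End SequenceAlgebra.

(** A pointwise limit of joint distributions is a joint distribution, in the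
    algebra of polynomial sequences with the limit expectation, whose positivity
    passes to the limit as the positive cone is closed.  The second conclusion
    transports the relations that hold at every stage, such as
    selfadjointness. *)
Lemma weak_limit_realization (R : realType) (B : cstarAlgType R)
    (A : nat -> bprobSpace B) (I : Type) (x : forall n, I -> A n)
    (mu : bpoly B I -> B) :
  weak_cvg (fun n => law (x n)) mu ->
  exists (L : bprobSpace B) (X : I -> L),
    law X =1 mu /\
    forall p q, (forall n, beval (binj (A n)) star (x n) p =
                           beval (binj (A n)) star (x n) q) ->
      beval (binj L) star X p = beval (binj L) star X q.
Proof.
move=> mu_lim; exists (seq_bprobSpace mu_lim), (@seq_var _ _ _ _ x); split.
  move=> p; apply: (seq_exp_lim mu_lim); apply: near_norm_cvg (mu_lim p).
  by near=> n; rewrite seq_of_beval.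
move=> p q pq; apply: seq_algebraP => n; rewrite !seq_of_beval; exact: pq.
Unshelve. all: end_near. Qed.

(** * Counting index paths *)

Section PathSum.
Context (n : nat) (V : nmodType).

Fixpoint path_sum (m : nat) (f : seq 'I_n -> V) : V :=
  if m is m'.+1 then \sum_i path_sum m' (fun p => f (i :: p)) else f [::].

Lemma eq_path_sum m (f g : seq 'I_n -> V) :
  (forall p, size p = m -> f p = g p) -> path_sum m f = path_sum m g.
Proof.
elim: m f g => [|m IH] f g fg /=; first exact: fg.
by apply: eq_bigr => i _; apply: IH => p sp; apply: fg; rewrite /= sp.
Qed.

Lemma path_sum0 m : path_sum m (fun=> 0) = 0.
Proof. by elim: m => //= m IH; rewrite big1. Qed.

End PathSum.

Lemma path_sum_morph (n : nat) (V W : nmodType) (h : V -> W) m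
    (f : seq 'I_n -> V) :
  h 0 = 0 -> {morph h : x y / x + y} ->
  h (path_sum m f) = path_sum m (h \o f).
Proof.
move=> h0 hD; elim: m f => //= m IH f.
by rewrite (big_morph h hD h0); apply: eq_bigr => i _; exact: IH.
Qed.

Lemma path_sumB (n : nat) (V : zmodType) m (f g : seq 'I_n -> V) :
  path_sum m f - path_sum m g = path_sum m (fun p => f p - g p).
Proof.
elim: m f g => //= m IH f g.
by rewrite -sumrB; apply: eq_bigr => i _; exact: IH.
Qed.

Lemma ler_path_sum (R : numDomainType) (n m : nat) (f g : seq 'I_n -> R) :
  (forall p, size p = m -> f p <= g p) -> path_sum m f <= path_sum m g.
Proof.
elim: m f g => [|m IH] f g fg /=; first exact: fg.
by apply: ler_sum => i _; apply: IH => p sp; apply: fg; rewrite /= sp.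
Qed.

Lemma cnorm_path_sum (R : realType) (B : cstarAlgType R) (n m : nat)
    (f : seq 'I_n -> B) :
  cnorm (path_sum m f) <= path_sum m (fun p => cnorm (f p)).
Proof.
elim: m f => //= m IH f; apply: le_trans (cnorm_sum _ _ _) _.
by apply: ler_sum => i _; exact: IH.
Qed.

Section Paths.
Context (n : nat).
Implicit Types (x y z : 'I_n) (p : seq 'I_n).

(** The path goes through [x], then [y], then along [p].  The edge [{x, y}] is
    matched when the step before it went along it too; leaving an unmatched edge
    would close a run of length 1.  Going on along [{x, y}] means going back to
    [x].  Labels of edges are ignored: this predicate is only a necessary
    condition for a nonzero expectation. *)
Fixpoint runs_ge2 (matched : bool) x y p : bool :=
  if p is z :: p' then
    if z == x then runs_ge2 true y z p'
    else matched && runs_ge2 false y z p'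
  else matched.

(** Among the paths in [runs_ge2], those with some run of length at least 3,
    where the runs up to [{x, y}] have length at most 2.  From the first time
    that a matched edge is used again, the rest is only constrained by
    [runs_ge2]. *)
Fixpoint excess (matched : bool) x y p : bool :=
  if p is z :: p' then
    if z == x then (if matched then runs_ge2 true y z p' else excess true y z p')
    else matched && excess false y z p'
  else false.

Lemma runs_ge2_matched x y p : runs_ge2 false x y p -> runs_ge2 true x y p.
Proof. by case: p => //= z p; case: eqP. Qed.

Section Count.
Context (R : realType) (u : R) (u1 : 1 <= u) (u2 : u ^+ 2 = n%:R).

Lemma sum_one_or_all (x : 'I_n) (F : 'I_n -> R) (a b : R) : 0 <= b ->
  F x <= a -> (forall z, z != x -> F z <= b) -> \sum_z F z <= a + u ^+ 2 * b.
Proof.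
move=> b0 Fx Fz; rewrite (bigD1 x) //= lerD //.
apply: le_trans (ler_sum _ (fun z => Fz z)) _.
rewrite sumr_const u2 -[b *+ _]mulr_natl ler_wpM2r // ler_nat.
by apply: leq_trans (max_card _) _; rewrite card_ord.
Qed.

(** With [u] the square root of [n], every step costs a factor [2u]: a new index
    costs [u^2], but forces the following step to go back.  The unmatched case
    gains [2u] as its first step is forced. *)
Lemma count_runs_ge2 m x y :
  path_sum m (fun p => (runs_ge2 true x y p)%:R) <= (2 * u) ^+ m /\
  path_sum m (fun p => (runs_ge2 false x y p)%:R) <= (2 * u) ^+ m / (2 * u).
Proof.
have u0 : 0 < u := lt_le_trans ltr01 u1.
elim: m x y => [|m IH] x y /=.
  by rewrite expr0 lexx mul1r invr_ge0 mulr_ge0 // ltW.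
have pos : 0 <= (2 * u) ^+ m by rewrite exprn_ge0 ?mulr_ge0 ?ltW.
have le_total : (2 * u) ^+ m + u ^+ 2 * ((2 * u) ^+ m / (2 * u)) <= (2 * u) ^+ m.+1.
  have -> : u ^+ 2 * ((2 * u) ^+ m / (2 * u)) = u / 2 * (2 * u) ^+ m.
    by field; rewrite gt_eqF.
  rewrite exprS -[X in X + _]mul1r -mulrDl ler_wpM2r //.
  by have := u1; lra.
split.
  apply: le_trans (sum_one_or_all (x := x) _ _ _) le_total.
  - by rewrite divr_ge0 // mulr_ge0 // ltW.
  - by rewrite eqxx; exact: (IH y x).1.
  - by move=> z /negPf ->; exact: (IH y z).2.
have -> : (2 * u) ^+ m.+1 / (2 * u) = (2 * u) ^+ m + u ^+ 2 * 0.
  by rewrite mulr0 addr0 exprSr mulfK // mulf_neq0 ?gt_eqF.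
apply: (sum_one_or_all (x := x)) => //.
- by rewrite eqxx; exact: (IH y x).1.
- by move=> z /negPf ->; rewrite path_sum0.
Qed.

(** One factor [u] less than in [count_runs_ge2]: a step that lengthens a run to
    3 introduces no new index. *)
Lemma count_excess m x y :
  path_sum m (fun p => (excess true x y p)%:R) <= (2 * u) ^+ m / u /\
  path_sum m (fun p => (excess false x y p)%:R) <= (2 * u) ^+ m / (2 * u ^+ 2).
Proof.
have u0 : 0 < u := lt_le_trans ltr01 u1.
elim: m x y => [|m IH] x y /=.
  by rewrite expr0 !mul1r !invr_ge0 mulr_ge0 ?exprn_ge0 // ltW.
have pos : 0 <= (2 * u) ^+ m by rewrite exprn_ge0 ?mulr_ge0 ?ltW.
split.
  have le_total : (2 * u) ^+ m + u ^+ 2 * ((2 * u) ^+ m / (2 * u ^+ 2))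
      <= (2 * u) ^+ m.+1 / u.
    have -> : u ^+ 2 * ((2 * u) ^+ m / (2 * u ^+ 2)) = 2^-1 * (2 * u) ^+ m.
      by field; rewrite gt_eqF.
    have -> : (2 * u) ^+ m.+1 / u = 2 * (2 * u) ^+ m.
      by rewrite exprS; field; rewrite gt_eqF.
    lra.
  apply: le_trans (sum_one_or_all (x := x) _ _ _) le_total.
  - by rewrite divr_ge0 // mulr_ge0 // exprn_ge0 // ltW.
  - by rewrite eqxx; exact: (count_runs_ge2 m y x).1.
  - by move=> z /negPf ->; exact: (IH y z).2.
have -> : (2 * u) ^+ m.+1 / (2 * u ^+ 2) = (2 * u) ^+ m / u + u ^+ 2 * 0.
  by rewrite mulr0 addr0 exprS; field; rewrite gt_eqF.
apply: (sum_one_or_all (x := x)) => //.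
- by rewrite eqxx; exact: (IH y x).1.
- by move=> z /negPf ->; rewrite path_sum0.
Qed.

End Count.
End Paths.

(** * Boolean independence along a path *)

Lemma bexp_mulr (R : realType) (B : cstarAlgType R) (A : bprobSpace B)
  (u : A) (b : B) : bexp A (u * binj A b) = bexp A u * b.
Proof. by have := bexp_bimod 1 u b; rewrite rmorph1 !mul1r. Qed.

Lemma bexp_mull (R : realType) (B : cstarAlgType R) (A : bprobSpace B)
  (b : B) (u : A) : bexp A (binj A b * u) = b * bexp A u.
Proof. by have := bexp_bimod b u 1; rewrite rmorph1 !mulr1. Qed.

Section BooleanPaths.
Context (R : realType) (B : cstarAlgType R) (A : bprobSpace B) (S : Type).
Context (n : nat) (a : S -> 'I_n -> 'I_n -> A) (eta : S -> {linear B -> B}).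
Implicit Types (x y z : 'I_n) (p : seq 'I_n) (d e : 'I_n -> B).

(** The index type of the independent family: an entry and its adjoint
    [a(j, i; s)] are indexed by a same edge. *)
Definition edge_type : Type := S * {ij : 'I_n * 'I_n | (ij.1 <= ij.2)%N}.

Hypothesis a_sym : forall s x y, a s x y = star (a s y x).
Hypothesis a_centered : forall s x y, bexp A (a s x y) = 0.
Hypothesis a_cov : forall s x y b,
  bexp A (a s x y * binj A b * a s y x) = (n%:R^-1 : R[i]) *: eta s b.
Hypothesis a_indep : boolean_independent
  (fun q : edge_type => a q.1 (val q.2).1 (val q.2).2).

Fact edge_subproof x y :
  ((if (x <= y)%N then (x, y) else (y, x)).1 <=
   (if (x <= y)%N then (x, y) else (y, x)).2)%N.
Proof. by case: (leqP x y) => [|/ltnW]. Qed.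

Definition edge s x y : edge_type :=
  (s, exist (fun ij : 'I_n * 'I_n => (ij.1 <= ij.2)%N) _ (edge_subproof x y)).

Lemma edgeC s x y : edge s x y = edge s y x.
Proof.
congr (_, _); apply: val_inj => /=.
by case: (ltngtP x y) => //= /ord_inj ->.
Qed.

(** Two successive steps along the same edge return to the starting point. *)
Lemma edge_backtrack s s' x y z : edge s x y = edge s' y z -> s = s' /\ z = x.
Proof.
move=> e; split; first by case: e.
have {e} : val (edge s x y).2 = val (edge s' y z).2 by rewrite e.
by rewrite /=; case: leqP => _; case: leqP => _ [] // *; congruence.
Qed.

Definition edge_val (q : edge_type) : A := a q.1 (val q.2).1 (val q.2).2.

Definition edge_eval (q : edge_type) (P : bpoly B unit) : A :=
  beval (binj A) star (fun=> edge_val q) P.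

Lemma edge_evalM q P Q :
  edge_eval q (BMul P Q) = edge_eval q P * edge_eval q Q.
Proof. by []. Qed.

(** The entry [a s x y] is the variable of its edge or its adjoint. *)
Definition letter x y : bpoly B unit :=
  if (x <= y)%N then BVar tt else BVarStar tt.

Definition step_poly (b : B) x y : bpoly B unit := BMul (BConst b) (letter x y).

Lemma step_polyE b s x y :
  edge_eval (edge s x y) (step_poly b x y) = binj A b * a s x y.
Proof.
rewrite /edge_eval /step_poly /letter /edge_val /=.
by case: leqP => //= _; rewrite -a_sym.
Qed.

Lemma const_term_step b x y : const_term (step_poly b x y) = 0.
Proof. by rewrite /const_term /step_poly /letter /=; case: ifP; rewrite /= mulr0. Qed.

Lemma const_termMl (P Q : bpoly B unit) : const_term P = 0 ->
  const_term (BMul P Q) = 0.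
Proof. by rewrite /const_term /= => ->; rewrite mul0r. Qed.

(** The entry [d] of a pair [(d, s)] is taken at the starting point of the step
    labelled [s], and [e] at the end point of the path. *)
Fixpoint path_prod x (L : seq (('I_n -> B) * S)) e p : A :=
  match L, p with
  | (d, s) :: L', y :: p' => binj A (d x) * a s x y * path_prod y L' e p'
  | _, _ => binj A (e x)
  end.

Definition cons_fun (T : Type) (t : T) (f : nat -> T) (k : nat) : T :=
  if k is k'.+1 then f k' else t.

(** The run decomposition: successive steps along a same edge merge into one
    polynomial without constant term in the variable of this edge. *)
Lemma path_blocks d s L e x y p : size p = size L ->
  exists (N : nat) (q : nat -> edge_type) (P : nat -> bpoly B unit),
    [/\ forall k, (k < N)%N -> q k <> q k.+1, forall k, const_term (P k) = 0,
        q 0%N = edge s x y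
      & path_prod x ((d, s) :: L) e (y :: p) =
        \prod_(k < N.+1) edge_eval (q k) (P k)].
Proof.
elim: L d s x y p => [|[d' s'] L IH] d s x y [|z p] //= sp.
  exists 0%N, (fun=> edge s x y),
    (fun=> BMul (step_poly (d x) x y) (BConst (e y))); split=> //.
    by move=> k; rewrite const_termMl // const_term_step.
  by rewrite big_ord1 edge_evalM step_polyE.
have [N [q [P [qN P0 q0 /= ->]]]] := IH d' s' y z p (succn_inj sp).
have [q1|q1] := pselect (edge s x y = q 0%N).
  exists N, q, (cons_fun (BMul (step_poly (d x) x y) (P 0%N)) (fun k => P k.+1)).
  split=> //.
    by case=> [|k] /=; [rewrite const_termMl ?const_term_step|exact: P0].
  rewrite [RHS]big_ord_recl /= edge_evalM -{1}q1 step_polyE -[RHS]mulrA.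
  by rewrite big_ord_recl.
exists N.+1, (cons_fun (edge s x y) q), (cons_fun (step_poly (d x) x y) P).
split=> //.
- by case=> [|k] //=; exact: qN.
- by case=> [|k] /=; [exact: const_term_step|exact: P0].
- by rewrite [RHS]big_ord_recl /= step_polyE.
Qed.

(** The consequence of Boolean independence on which all path computations
    rest: a run that the next step does not continue splits off. *)
Lemma factor_edge q P d s L e x y p : const_term P = 0 -> q <> edge s x y ->
  size p = size L ->
  bexp A (edge_eval q P * path_prod x ((d, s) :: L) e (y :: p)) =
  bexp A (edge_eval q P) * bexp A (path_prod x ((d, s) :: L) e (y :: p)).
Proof.
move=> P0 qe sp; have [N [q' [P' [qN P'0 q'0 ->]]]] := path_blocks d s e x y sp.
rewrite [X in _ = _ * X](a_indep (i := q') (P := P')) //.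
have h := @a_indep N.+2 (cons_fun q q') (cons_fun P P').
rewrite /= big_ord_recl [X in _ = X]big_ord_recl in h; apply: h.
- by case=> [|k] /= kN; [rewrite q'0|exact: qN].
- by case.
Qed.

(** The two statements, according to whether the edge [{x, y}] is unmatched or
    belongs to a run, summed up in [P], of length at least 2, are proved by one
    induction.  A run of length 1 that is not continued splits off and is
    centered. *)
Lemma path_vanish p : forall L e x y s, size p = size L ->
  (forall d, ~~ runs_ge2 false x y p ->
     bexp A (path_prod x ((d, s) :: L) e (y :: p)) = 0) /\
  (forall P, const_term P = 0 -> ~~ runs_ge2 true x y p ->
     bexp A (edge_eval (edge s x y) P * path_prod y L e p) = 0).
Proof.
elim: p => [|z p IH] [|[d' s'] L] e x y s //= sp.
  split=> // d _.
  by rewrite -[_ * a s x y * _]mulrA mulrA bexp_bimod a_centered mulr0 mul0r.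
move/succn_inj in sp.
have merge P : const_term P = 0 -> edge s x y = edge s' y z ->
    ~~ runs_ge2 true y z p ->
    bexp A (edge_eval (edge s x y) P *
            (binj A (d' y) * a s' y z * path_prod z L e p)) = 0.
  move=> P0 exy nr; rewrite mulrA -step_polyE exy.
  have [_ h] := IH L e y z s' sp.
  exact: (h (BMul P (step_poly (d' y) y z)) (const_termMl _ P0)).
have [exy|exy] := pselect (edge s x y = edge s' y z).
  have [_ zx] := edge_backtrack exy; subst z; rewrite eqxx.
  split=> [d nr|P P0 nr]; last exact: merge.
  by rewrite -step_polyE; apply: merge; rewrite ?const_term_step.
split=> [d nr|P P0 nr].
  rewrite -step_polyE factor_edge ?const_term_step // step_polyE.
  by rewrite bexp_mull a_centered mulr0 mul0r.
rewrite factor_edge // [X in _ * X](proj1 (IH L e y z s' sp)) ?mulr0 //.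
by move: nr; case: eqP => // _; apply: contra; exact: runs_ge2_matched.
Qed.

(** The expectation of a path all of whose runs have length exactly 2, extended
    to every path of the form [x, y_1, x, y_2, x, ...].  The extension makes
    the sum over the [y_k] factorize; the paths in which two successive [y_k]
    are equal are all in [excess]. *)
Fixpoint path_val x (L : seq (('I_n -> B) * S)) e p : B :=
  match L, p with
  | [::], [::] => e x
  | (d, s) :: (d', s') :: L', y :: z :: p' =>
      if `[< s = s' >] && (z == x)
      then d x * ((n%:R^-1 : R[i]) *: eta s (d' y)) * path_val x L' e p'
      else 0
  | _, _ => 0
  end.

Lemma path_val_runs_ge2 p : forall d s L e x y,
  path_val x ((d, s) :: L) e (y :: p) <> 0 -> runs_ge2 false x y p.
Proof.
have [m] := ubnP (size p); elim: m p => // m IH [|z p] pm d s [|[d' s'] L] e x y //=.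
case: ifP => // /andP[_ /eqP ->]; rewrite eqxx.
case: p pm => [|w p] //= pm; case: L => [|[d2 s2] L]; first by rewrite mulr0.
move=> h; have {h} : path_val x ((d2, s2) :: L) e (w :: p) <> 0.
  by move=> h0; apply: h; rewrite h0 mulr0.
move=> /(IH p _) h; have {}h := h (ltnW pm).
by case: eqP => // _; exact: runs_ge2_matched.
Qed.

(** Outside of [excess] the path either has a run of length 1, and both sides
    vanish, or has runs of length exactly 2, whose expectations are given by
    the covariance.  As in [path_vanish], the unmatched and the matched cases
    need each other. *)
Lemma path_prod_val p : forall L e x y s, size p = size L ->
  (forall d, ~~ excess false x y p ->
     bexp A (path_prod x ((d, s) :: L) e (y :: p)) =
     path_val x ((d, s) :: L) e (y :: p)) /\
  (forall P, const_term P = 0 -> ~~ excess true x y p ->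
     bexp A (edge_eval (edge s x y) P * path_prod y L e p) =
     bexp A (edge_eval (edge s x y) P) * path_val y L e p).
Proof.
elim: p => [|z p IH] [|[d' s'] L] e x y s sp //.
  split=> [d _|P _ _] /=.
    by rewrite bexp_bimod a_centered mulr0 mul0r.
  exact: bexp_mulr.
have sp' := succn_inj sp; split=> [d nx|P P0 nx].
  have [exy|exy] := pselect (edge s x y = edge s' y z).
    have [ss' zx] := edge_backtrack exy; subst s' z.
    rewrite /= eqxx in nx.
    have [_ h] := IH L e y x s sp'.
    have {}h := h (BMul (step_poly (d x) x y) (step_poly (d' y) y x))
      (const_termMl _ (const_term_step _ _ _)) nx.
    have evE : edge_eval (edge s y x)
        (BMul (step_poly (d x) x y) (step_poly (d' y) y x)) =
        binj A (d x) * (a s x y * binj A (d' y) * a s y x) * binj A 1.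
      rewrite edge_evalM step_polyE -edgeC step_polyE.
      by rewrite rmorph1 mulr1 !mulrA.
    rewrite evE bexp_bimod a_cov mulr1 in h.
    by rewrite /= eqxx asboolT //= -h rmorph1 mulr1 !mulrA.
  transitivity (0 : B).
    rewrite -[path_prod _ _ _ _]/(_ * a s x y * path_prod y ((d', s') :: L) e (z :: p)).
    rewrite -step_polyE factor_edge ?const_term_step // step_polyE.
    by rewrite bexp_mull a_centered mulr0 mul0r.
  rewrite /=; case: ifP => // /andP[/asboolP ss' /eqP zx].
  by case: exy; rewrite ss' zx edgeC.
rewrite /= in nx; have [zx|zx] := eqVneq z x.
  rewrite zx eqxx in nx *.
  (* The run is lengthened to 3: as the path is not in [excess], the rest of it
     contains a run of length 1. *)
  have -> : path_val y ((d', s') :: L) e (x :: p) = 0.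
    apply: contrapT => /path_val_runs_ge2 h.
    by case/negP: nx; exact: runs_ge2_matched.
  have [_ h] := @path_vanish (x :: p) ((d', s') :: L) e x y s sp.
  by rewrite h ?mulr0 //= eqxx.
rewrite (negPf zx) in nx; rewrite factor_edge //.
  by rewrite (proj1 (IH L e y z s' sp')).
by move=> /edge_backtrack[_ zx']; rewrite zx' eqxx in zx.
Qed.

End BooleanPaths.

(** * Words in matrices as sums over paths *)

Section Pairing.
Context (X S : Type) (U : pzRingType) (g : X -> U) (f : S -> X -> U).

(** The product [g P_1 f_(s_1)(P_2) g P_3 f_(s_3)(P_4) ... g e] when the labels
    agree in pairs, and 0 otherwise.  It is used with [f s] for [eta_s] of a
    mean, of a limit expectation, or of an element of [B]. *)
Fixpoint pairing (L : seq (X * S)) (e : X) : U :=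
  match L with
  | [::] => g e
  | (d, s) :: (d', s') :: L' =>
      if `[< s = s' >] then g d * f s d' * pairing L' e else 0
  | _ => 0
  end.

Lemma pairing_ind (P : seq (X * S) -> Prop) :
  P [::] -> (forall ds, P [:: ds]) ->
  (forall ds ds' L, P L -> P [:: ds, ds' & L]) -> forall L, P L.
Proof.
move=> P0 P1 P2 L; have [m] := ubnP (size L).
elim: m L => // m IH [|ds [|ds' L]] //= Lm.
by apply/P2/IH; rewrite ltnS in Lm; exact: ltnW.
Qed.

End Pairing.

Lemma cnorm_invnZ (R : realType) (B : cstarAlgType R) (n : nat) (b : B) :
  cnorm ((n%:R^-1 : R[i]) *: b) = n%:R^-1 * cnorm b.
Proof.
have -> : n%:R^-1 = (n%:R^-1)%:C%C :> R[i] by rewrite fmorphV rmorph_nat.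
by rewrite cnorm_rscale ger0_norm // invr_ge0.
Qed.

Lemma ler_sum_ord (R : numDomainType) (n : nat) (F : 'I_n -> R) (c : R) :
  (forall i, F i <= c) -> \sum_i F i <= n%:R * c.
Proof.
move=> Fc; apply: le_trans (ler_sum _ (fun i _ => Fc i)) _.
by rewrite sumr_const card_ord mulr_natl.
Qed.

Section WordMatrices.
Context (R : realType) (B : cstarAlgType R) (A : bprobSpace B) (S : Type).
Context (n : nat) (a : S -> 'I_n -> 'I_n -> A) (eta : S -> {linear B -> B}).
Implicit Types (x y z : 'I_n) (p : seq 'I_n) (d e : 'I_n -> B).

Definition mean d : B := (n%:R^-1 : R[i]) *: \sum_i d i.

Definition diagA d : 'M[A]_n := diag_mx (\row_i binj A (d i)).

Fixpoint word_mx (L : seq (('I_n -> B) * S)) e : 'M[A]_n :=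
  if L is (d, s) :: L' then
    diagA d *m (\matrix_(i, j) a s i j) *m word_mx L' e
  else diagA e.

Lemma word_mxE L e x z :
  word_mx L e x z =
  path_sum (size L) (fun p => if last x p == z then path_prod a x L e p else 0).
Proof.
elim: L x => [|[d s] L IH] x /=.
  by rewrite !mxE; case: eqP; rewrite ?mulr1n ?mulr0n.
rewrite mxE; apply: eq_bigr => y _; rewrite IH mul_diag_mx !mxE.
rewrite (path_sum_morph (h := fun v => binj A (d x) * a s x y * v)).
- by apply: eq_path_sum => p _ /=; case: eqP; rewrite ?mulr0.
- by rewrite mulr0.
- by move=> u v /=; rewrite mulrDr.
Qed.

(** The condition on the last index says that the paths are closed. *)
Definition trace_sum (m : nat) (F : 'I_n -> seq 'I_n -> B) : B :=
  mean (fun x => path_sum m (fun p => if last x p == x then F x p else 0)).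

Lemma mx_bexp_word L e : mx_bexp (word_mx L e) =
  trace_sum (size L) (fun x p => bexp A (path_prod a x L e p)).
Proof.
rewrite /mx_bexp; congr (_ *: _); apply: eq_bigr => x _.
rewrite word_mxE (path_sum_morph (h := bexp A)) ?linear0 //; last exact: linearD.
by apply: eq_path_sum => p _ /=; case: eqP; rewrite ?linear0.
Qed.

Lemma trace_sum_path_val L e :
  trace_sum (size L) (fun x p => path_val eta x L e p) =
  mean (fun x => pairing (fun d => d x) (fun s d => eta s (mean d)) L e).
Proof.
congr (_ *: _); apply: eq_bigr => x _; elim/(@pairing_ind ('I_n -> B) S): L => [|[d s]|].
- by rewrite /= eqxx.
- by rewrite /= big1 // => y _; rewrite if_same.
move=> [d s] [d' s'] L IH /=; case: asboolP => ss'; last first.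
  rewrite big1 // => y _; rewrite big1 // => z _.
  by rewrite -[RHS](path_sum0 n B (size L)); apply: eq_path_sum => p _; rewrite if_same.
rewrite -IH /mean linearZ /= [eta s (\sum_(_ < _) _)]linear_sum scaler_sumr mulr_sumr mulr_suml.
apply: eq_bigr => y _; rewrite (bigD1 x) //= [X in _ + X]big1 => [|z zx]; last first.
  rewrite -[RHS](path_sum0 n B (size L)); apply: eq_path_sum => p _.
  by rewrite (negPf zx) if_same.
rewrite addr0 eqxx (path_sum_morph
  (h := fun v => d x * ((n%:R^-1 : R[i]) *: eta s (d' y)) * v)).
- by apply: eq_path_sum => p _ /=; case: eqP; rewrite ?mulr0.
- by rewrite mulr0.
- by move=> u v /=; rewrite mulrDr.
Qed.

Fixpoint bounded_word (K : R) (L : seq (('I_n -> B) * S)) : Prop :=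
  if L is (d, _) :: L' then (forall x, cnorm (d x) <= K) /\ bounded_word K L'
  else True.

Lemma path_prod_word K m : forall L e x p,
  size L = m.+1 -> size p = m.+1 -> bounded_word K L ->
  (forall x, cnorm (e x) <= K) ->
  exists b0 b1 (b : nat -> B) (s : nat -> S) (i j : nat -> 'I_n),
    [/\ cnorm b0 <= K, cnorm b1 <= K, forall k, cnorm (b k) <= K
      & path_prod a x L e p =
        binj A b0 * ((\prod_(k < m) (a (s k) (i k) (j k) * binj A (b k))) *
                     a (s m) (i m) (j m)) * binj A b1].
Proof.
elim: m => [|m IH] [|[d s] L] e x [|y p] //= [sL] [sp] [dK LK] eK.
  case: L p sL sp {LK} => // -[] // _ _.
  exists (d x), (e y), (fun=> d x), (fun=> s), (fun=> x), (fun=> y).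
  by split=> //; rewrite big_ord0 mul1r.
have [b0 [b1 [b [s' [i [j [b0K b1K bK ->]]]]]]] := IH L e y p sL sp LK eK.
exists (d x), b1, (cons_fun b0 b), (cons_fun s s'), (cons_fun x i), (cons_fun y j).
split=> //; first by case.
by rewrite big_ord_recl /= !mulrA.
Qed.

Lemma path_prod_bound (K M c : R) m L e x p : 0 <= K -> 0 <= M * c ->
  (forall (b : nat -> B) (s : nat -> S) (i j : nat -> 'I_n),
    cnorm (bexp A ((\prod_(k < m) (a (s k) (i k) (j k) * binj A (b k))) *
                   a (s m) (i m) (j m)))
    <= M * c * \prod_(k < m) cnorm (b k)) ->
  size L = m.+1 -> size p = m.+1 -> bounded_word K L ->
  (forall x, cnorm (e x) <= K) ->
  cnorm (bexp A (path_prod a x L e p)) <= M * c * K ^+ m.+2.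
Proof.
move=> K0 Mc0 hM sL sp LK eK.
have [b0 [b1 [b [s [i [j [b0K b1K bK ->]]]]]]] := path_prod_word x sL sp LK eK.
rewrite bexp_bimod; set E := bexp _ _.
have EK : cnorm E <= M * c * K ^+ m.
  rewrite (le_trans (hM b s i j)) // ler_wpM2l //.
  rewrite -[X in _ <= _ ^+ X](card_ord m) -prodr_const; apply: ler_prod => k _.
  by rewrite cnorm_ge0 bK.
rewrite (le_trans (cnormM _ _)) //.
have -> : M * c * K ^+ m.+2 = K * (M * c * K ^+ m) * K by rewrite !exprS; ring.
apply: ler_pM => //; rewrite ?cnorm_ge0 // (le_trans (cnormM _ _)) //.
by apply: ler_pM; rewrite ?cnorm_ge0.
Qed.

Context (u : R) (u1 : 1 <= u) (u2 : u ^+ 2 = n%:R).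

Lemma path_val_bound (K H : R) L e x p : 0 <= K -> 1 <= H ->
  (forall s b, cnorm (eta s b) <= H * cnorm b) ->
  bounded_word K L -> (forall x, cnorm (e x) <= K) ->
  cnorm (path_val eta x L e p) <= K * (H * K / u) ^+ size L.
Proof.
move=> K0 H1 etaH + eK; have H0 : 0 <= H := le_trans ler01 H1.
have u0 : 0 < u := lt_le_trans ltr01 u1.
have base0 m : 0 <= K * (H * K / u) ^+ m.
  by rewrite mulr_ge0 // exprn_ge0 // divr_ge0 ?mulr_ge0 // ltW.
elim/(@pairing_ind ('I_n -> B) S): L x p => [|[d s]|] x.
- by move=> [|y p] _ /=; rewrite ?expr0 ?mulr1 ?cnorm0.
- by move=> [|y p] _; rewrite -[path_val _ _ _ _ _]/(0 : B) cnorm0.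
move=> [d' s'] L IH z p; case: x => d s [dK [d'K LK]].
have triv : cnorm (0 : B) <= K * (H * K / u) ^+ (size L).+2 by rewrite cnorm0.
case: p => [|y [|w p]] //; rewrite /path_val -/path_val.
case: ifP => // _; rewrite !exprS.
have -> : K * (H * K / u * (H * K / u * (H * K / u) ^+ size L)) =
  K * (n%:R^-1 * (H * K) * H) * (K * (H * K / u) ^+ size L).
  by rewrite -u2; field; rewrite gt_eqF.
rewrite (le_trans (cnormM _ _)) //; apply: ler_pM; rewrite ?cnorm_ge0 //.
  rewrite (le_trans (cnormM _ _)) //; apply: ler_pM; rewrite ?cnorm_ge0 //.
  rewrite cnorm_invnZ -mulrA ler_wpM2l ?invr_ge0 // (le_trans (etaH _ _)) //.
  apply: le_trans (ler_peMr _ H1); last by rewrite mulr_ge0.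
  by rewrite ler_wpM2l.
exact: IH.
Qed.

Hypothesis a_sym : forall s x y, a s x y = star (a s y x).
Hypothesis a_centered : forall s x y, bexp A (a s x y) = 0.
Hypothesis a_cov : forall s x y b,
  bexp A (a s x y * binj A b * a s y x) = (n%:R^-1 : R[i]) *: eta s b.
Hypothesis a_indep : boolean_independent
  (fun q : edge_type S n => a q.1 (val q.2).1 (val q.2).2).

(** The two sums over paths differ only on [excess].  There are at most
    [n^2 (2u)^m / (2 u^2)] such paths, and each term is at most
    [(M + H^(m+1)) K^(m+2) / u^(m+1)]; the trace divides by [n]. *)
Lemma mx_bexp_word_estimate (K M H : R) m L e : 0 <= K -> 0 <= M -> 1 <= H ->
  size L = m.+1 ->
  (forall s b, cnorm (eta s b) <= H * cnorm b) ->
  (forall (b : nat -> B) (s : nat -> S) (i j : nat -> 'I_n),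
    cnorm (bexp A ((\prod_(k < m) (a (s k) (i k) (j k) * binj A (b k))) *
                   a (s m) (i m) (j m)))
    <= M * u ^- m.+1 * \prod_(k < m) cnorm (b k)) ->
  bounded_word K L -> (forall x, cnorm (e x) <= K) ->
  cnorm (mx_bexp (word_mx L e) -
         mean (fun x => pairing (fun d => d x) (fun s d => eta s (mean d)) L e))
  <= 2 ^+ m * (M + H ^+ m.+1) * (K ^+ m.+2 / u).
Proof.
move=> K0 M0 H1 sL etaH hM LK eK.
have u0 : 0 < u := lt_le_trans ltr01 u1; have H0 : 0 <= H := le_trans ler01 H1.
rewrite -trace_sum_path_val mx_bexp_word /trace_sum /mean -scalerBr -sumrB.
rewrite sL cnorm_invnZ -u2.
pose D := (M + H ^+ m.+1) * (K ^+ m.+2 / u ^+ m.+1).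
have D0 : 0 <= D.
  by rewrite mulr_ge0 ?addr_ge0 ?divr_ge0 ?exprn_ge0 // ltW.
have termD x p : size p = m.+1 ->
    cnorm (bexp A (path_prod a x L e p) - path_val eta x L e p) <= D.
  move=> sp; rewrite (le_trans (cnormB_le _ _)) // /D mulrDl lerD //.
    rewrite mulrA mulrAC; apply: path_prod_bound hM sL sp LK eK => //.
    by rewrite mulr_ge0 // invr_ge0 exprn_ge0 // ltW.
  apply: le_trans (path_val_bound x p K0 H1 etaH LK eK) _.
  by rewrite sL expr_div_n exprMn [K ^+ m.+2]exprS !mulrA [K * _]mulrC.
have pathD x y p : size p = m ->
    cnorm ((if last y p == x then bexp A (path_prod a x L e (y :: p)) else 0) -
           (if last y p == x then path_val eta x L e (y :: p) else 0))
    <= D * (excess false x y p)%:R.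
  case: L sL {LK} termD => // -[d s] L [sL] termD sp.
  case: eqP => _; last by rewrite subrr cnorm0 mulr_ge0.
  have [xs|xs] := boolP (excess false x y p).
    by rewrite mulr1; apply: termD; rewrite /= sp.
  have [h _] := path_prod_val a_sym a_centered a_cov a_indep e x y s (etrans sp (esym sL)).
  by rewrite h // subrr cnorm0 mulr0.
have sumD x : cnorm (path_sum m.+1 (fun p => if last x p == x then
        bexp A (path_prod a x L e p) else 0) -
      path_sum m.+1 (fun p => if last x p == x then path_val eta x L e p else 0))
    <= u ^+ 2 * (D * ((2 * u) ^+ m / (2 * u ^+ 2))).
  rewrite path_sumB /=; apply: le_trans (cnorm_sum _ _ _) _.
  rewrite [X in _ <= X * _]u2; apply: ler_sum_ord => y.
  apply: le_trans (cnorm_path_sum _ _) _.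
  apply: le_trans (ler_path_sum (pathD x y)) _.
  rewrite -(path_sum_morph (h := fun v => D * v)) ?mulr0 //; last first.
    by move=> v w /=; rewrite mulrDr.
  by rewrite ler_wpM2l //; exact: (count_excess u1 u2 m x y).2.
apply: le_trans (_ : u ^- 2 * (u ^+ 2 * (u ^+ 2 * (D * ((2 * u) ^+ m / (2 * u ^+ 2))))) <= _).
  apply: ler_wpM2l; first by rewrite invr_ge0 exprn_ge0 // ltW.
  apply: le_trans (cnorm_sum _ _ _) _; rewrite [X in _ <= X * _]u2.
  exact: ler_sum_ord.
have -> : u ^- 2 * (u ^+ 2 * (u ^+ 2 * (D * ((2 * u) ^+ m / (2 * u ^+ 2))))) =
  2^-1 * (2 ^+ m * (M + H ^+ m.+1) * (K ^+ m.+2 / u)).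
  rewrite /D exprMn !exprS; field.
  by rewrite gt_eqF // gt_eqF ?exprn_gt0.
have : 0 <= 2 ^+ m * (M + H ^+ m.+1) * (K ^+ m.+2 / u).
  apply: mulr_ge0; last by rewrite divr_ge0 ?exprn_ge0 // ltW.
  by rewrite mulr_ge0 ?addr_ge0 ?exprn_ge0.
lra.
Qed.

End WordMatrices.

(** * Arrays of subpolynomial growth and bounded power means *)

Section Arrays.
Context (R : realType).
Implicit Types r q : forall n, 'I_n -> R.

(** The largest entry grows slower than every power of [n]. *)
Definition small_array r : Prop := forall k : nat,
  \forall n \near \oo, forall i : 'I_n, `|r n i| ^+ k <= n%:R.

Definition tame_array r : Prop := forall k : nat, exists C : R,
  \forall n \near \oo, n%:R^-1 * \sum_(i < n) `|r n i| ^+ k <= C.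

(** What makes a growth condition pass from the diagonal matrices to the
    polynomials in them. *)
Record array_ideal (Q : (forall n, 'I_n -> R) -> Prop) : Prop := ArrayIdeal {
  ideal_cst : forall c : R, Q (fun n i => c);
  ideal_le : forall r q, (forall n i, `|r n i| <= `|q n i|) -> Q q -> Q r;
  ideal_D : forall r q, Q r -> Q q -> Q (fun n i => r n i + q n i);
  ideal_M : forall r q, Q r -> Q q -> Q (fun n i => r n i * q n i)
}.

Lemma exprD_le (x y : R) k : 0 <= x -> 0 <= y ->
  (x + y) ^+ k <= 2 ^+ k * (x ^+ k + y ^+ k).
Proof.
move=> x0 y0.
wlog xy : x y x0 y0 / x <= y.
  move=> h; case: (leP x y) => [|/ltW] xy; first exact: h.
  by rewrite addrC [X in _ * X]addrC; exact: h.
apply: le_trans (_ : (2 * y) ^+ k <= _).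
  by apply: lerXn2r; rewrite ?nnegrE ?addr_ge0 ?mulr_ge0 //; lra.
by rewrite exprMn ler_wpM2l ?exprn_ge0 // lerDr exprn_ge0.
Qed.

Lemma exprM_le (x y : R) k : (x * y) ^+ k <= x ^+ (k * 2) + y ^+ (k * 2).
Proof.
rewrite exprMn !exprM; have := sqr_ge0 (x ^+ k - y ^+ k).
have := sqr_ge0 (x ^+ k); have := sqr_ge0 (y ^+ k); rewrite sqrrB.
set X := x ^+ k; set Y := y ^+ k; rewrite -mulr_natl; nra.
Qed.

(** For a sum or product, the condition of exponent [2k] on the operands gives
    that of exponent [k], the constants being absorbed by [n]. *)
Lemma small_array_ideal : array_ideal small_array.
Proof.
split.
- move=> c k; near=> n; move=> _; near: n.
  exact: nbhs_infty_ger.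
- move=> r q rq qs k; near=> n.
  have qn : forall i : 'I_n, `|q n i| ^+ k <= n%:R by near: n; exact: qs.
  by move=> i; rewrite (le_trans _ (qn i)) // lerXn2r ?nnegrE.
- move=> r q rs qs k; near=> n.
  have rn : forall i : 'I_n, `|r n i| ^+ (k * 2) <= n%:R by near: n; exact: rs.
  have qn : forall i : 'I_n, `|q n i| ^+ (k * 2) <= n%:R by near: n; exact: qs.
  have cn : 4 ^+ k.+1 <= n%:R :> R by near: n; exact: nbhs_infty_ger.
  move=> i; apply: le_trans (_ : (`|r n i| + `|q n i|) ^+ k <= _).
    by rewrite lerXn2r ?nnegrE ?addr_ge0 // ler_normD.
  rewrite (le_trans (exprD_le _ _ _)) //.
  have := rn i; have := qn i; rewrite !exprM.
  set X := `|r n i| ^+ k; set Y := `|q n i| ^+ k => Yn Xn.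
  have X0 : 0 <= X by rewrite exprn_ge0.
  have Y0 : 0 <= Y by rewrite exprn_ge0.
  rewrite -(ler_pXn2r (n := 2)) ?nnegrE //; last first.
    by rewrite mulr_ge0 ?exprn_ge0 ?addr_ge0.
  rewrite exprMn exprAC -[2 ^+ 2]/(2 * 2 : R) -natrM.
  apply: le_trans (_ : 4 ^+ k * (4 * n%:R) <= _).
    by rewrite ler_wpM2l ?exprn_ge0 //; have := sqr_ge0 (X - Y); nra.
  by rewrite mulrA -exprSr [n%:R ^+ 2]expr2 ler_wpM2r.
- move=> r q rs qs k; near=> n.
  have rn : forall i : 'I_n, `|r n i| ^+ (k * 2) <= n%:R by near: n; exact: rs.
  have qn : forall i : 'I_n, `|q n i| ^+ (k * 2) <= n%:R by near: n; exact: qs.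
  move=> i; rewrite -(ler_pXn2r (n := 2)) ?nnegrE ?exprn_ge0 //.
  rewrite normrM -exprM exprMn [n%:R ^+ 2]expr2.
  by apply: ler_pM; rewrite ?exprn_ge0.
Unshelve. all: end_near. Qed.

Lemma mean_le n (f g : 'I_n -> R) : (forall i, f i <= g i) ->
  n%:R^-1 * \sum_i f i <= n%:R^-1 * \sum_i g i.
Proof. by move=> fg; rewrite ler_wpM2l ?invr_ge0 // ler_sum. Qed.

Lemma tame_array_near_bounded r (C : R) :
  (\forall n \near \oo, forall i, `|r n i| <= C) -> tame_array r.
Proof.
move=> rC k; exists (`|C| ^+ k); near=> n.
have n0 : (0 < n)%N by near: n; exact: nbhs_infty_gt.
have rn : forall i : 'I_n, `|r n i| <= C by near: n.
apply: le_trans (_ : n%:R^-1 * \sum_(i < n) `|C| ^+ k <= _).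
  apply: mean_le => i; rewrite lerXn2r ?nnegrE // (le_trans (rn i)) //.
  exact: ler_norm.
rewrite sumr_const card_ord -[X in _ * X]mulr_natl mulrA mulVf ?mul1r //.
by rewrite pnatr_eq0 -lt0n.
Unshelve. all: end_near. Qed.

Lemma tame_array_ideal : array_ideal tame_array.
Proof.
split.
- by move=> c; apply: (@tame_array_near_bounded _ `|c|); near=> n.
- move=> r q rq qt k; have [C qC] := qt k; exists C; near=> n.
  apply: le_trans (_ : n%:R^-1 * \sum_(i < n) `|q n i| ^+ k <= _).
    by apply: mean_le => i; rewrite lerXn2r ?nnegrE.
  by near: n.
- move=> r q rt qt k; have [C rC] := rt k; have [D qD] := qt k.
  exists (2 ^+ k * (C + D)); near=> n.
  apply: le_trans (_ : n%:R^-1 *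
      \sum_(i < n) (2 ^+ k * (`|r n i| ^+ k + `|q n i| ^+ k)) <= _).
    apply: mean_le => i; rewrite (le_trans _ (exprD_le _ _ _)) //.
    by rewrite lerXn2r ?nnegrE ?addr_ge0 // ler_normD.
  rewrite -mulr_sumr mulrCA big_split /= mulrDr ler_wpM2l ?exprn_ge0 //.
  by apply: lerD; near: n.
- move=> r q rt qt k; have [C rC] := rt (k * 2)%N; have [D qD] := qt (k * 2)%N.
  exists (C + D); near=> n.
  apply: le_trans (_ : n%:R^-1 *
      \sum_(i < n) (`|r n i| ^+ (k * 2) + `|q n i| ^+ (k * 2)) <= _).
    by apply: mean_le => i; rewrite normrM exprM_le.
  rewrite big_split /= mulrDr.
  by apply: lerD; near: n.
Unshelve. all: end_near. Qed.

Lemma small_array_root r m : (0 < m)%N -> small_array r ->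
  \forall n \near \oo, forall i, `|r n i| <= n%:R `^ (m%:R^-1).
Proof.
move=> m0 rs; near=> n.
have rn : forall i : 'I_n, `|r n i| ^+ m <= n%:R by near: n; exact: rs.
move=> i; have -> : `|r n i| = (`|r n i| ^+ m) `^ m%:R^-1.
  by rewrite -powR_mulrn // -powRrM mulfV ?powRr1 // pnatr_eq0 -lt0n.
by apply: ge0_ler_powR; rewrite ?nnegrE ?invr_ge0 ?exprn_ge0.
Unshelve. all: end_near. Qed.

Lemma cvg_fourth_root (v : nat -> R) :
  (\forall n \near \oo, 0 <= v n /\ v n ^+ 4 = n%:R^-1) -> v @ \oo --> (0 : R).
Proof.
move=> v4; apply/cvgrPdist_lt => e e0; near=> n.
have [v0 vn] : 0 <= v n /\ v n ^+ 4 = n%:R^-1 by near: n.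
rewrite sub0r normrN ger0_norm // -(ltr_pXn2r (n := 4)) ?nnegrE ?(ltW e0) // vn.
have e4 : 0 < e ^+ 4 by rewrite exprn_gt0.
rewrite invf_plt ?posrE //; first by near: n; exact: nbhs_infty_gtr.
by rewrite ltr0n; near: n; exact: nbhs_infty_gt.
Unshelve. all: end_near. Qed.

End Arrays.

(** * The limit of the surviving term *)

Section DiagonalPolynomials.
Context (R : realType) (B : cstarAlgType R) (T : Type).
Context (b : forall n : nat, T -> 'I_n -> B).
Arguments b : clear implicits.

Definition diag_poly (P : bpoly B T) (n : nat) (i : 'I_n) : B :=
  beval id star (fun t => b n t i) P.
Arguments diag_poly : clear implicits.

Lemma diag_poly_ideal (Q : (forall n, 'I_n -> R) -> Prop) (P : bpoly B T) :
  array_ideal Q -> (forall t, Q (fun n i => cnorm (b n t i))) ->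
  Q (fun n i => cnorm (diag_poly P n i)).
Proof.
move=> Qid Qb; elim: P => [c|t|t|P QP P' QP'|P QP P' QP'].
- exact: (ideal_cst Qid (cnorm c)).
- exact: (Qb t).
- by apply: (ideal_le Qid _ (Qb t)) => n i; rewrite /diag_poly /= cnorm_starE.
- apply: (ideal_le Qid _ (ideal_D Qid QP QP')) => n i.
  by rewrite !ger0_norm ?addr_ge0 ?cnorm_ge0 // cnormD.
- apply: (ideal_le Qid _ (ideal_M Qid QP QP')) => n i.
  by rewrite !ger0_norm ?mulr_ge0 ?cnorm_ge0 // cnormM.
Qed.

End DiagonalPolynomials.
Arguments diag_poly {R B T} b P n i.

Lemma cnorm_mean_le (R : realType) (B : cstarAlgType R) n (d : 'I_n -> B) :
  cnorm (mean d) <= n%:R^-1 * \sum_i cnorm (d i).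
Proof. by rewrite cnorm_invnZ ler_wpM2l ?invr_ge0 // cnorm_sum. Qed.

Section MainTerm.
Context (R : realType) (B : cstarAlgType R) (S T : Type).
Context (eta : S -> {linear B -> B}) (H : R).
Hypothesis eta_bound : forall s c, cnorm (eta s c) <= H * cnorm c.
Context (b : forall n : nat, T -> 'I_n -> B) (phi : bpoly B T -> B).
Arguments b : clear implicits.
Hypothesis b_tame : forall t, tame_array (fun n i => cnorm (b n t i)).
Hypothesis b_cvg : forall P, norm_cvg (fun n => mean (diag_poly b P n)) (phi P).

(** [pairing] with limit expectations, as a polynomial in the diagonal
    variables alone. *)
Fixpoint pair_poly (W : seq (bpoly B T * S)) (e : bpoly B T) : bpoly B T :=
  match W with
  | [::] => e
  | (P, s) :: (P', s') :: W' =>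
      if `[< s = s' >]
      then BMul (BMul P (BConst (eta s (phi P')))) (pair_poly W' e)
      else BConst 0
  | _ => BConst 0
  end.

Lemma beval_pair_poly (U : pzRingType) (inj : B -> U) st x W e :
  inj 0 = 0 ->
  beval inj st x (pair_poly W e) =
  pairing (beval inj st x) (fun s P => inj (eta s (phi P))) W e.
Proof.
move=> inj0; elim/(@pairing_ind (bpoly B T) S): W => //= [[P s] //|].
by move=> [P s] [P' s'] W IH; case: asboolP => //= _; rewrite IH.
Qed.

Let random_pairing n (i : 'I_n) W e : B :=
  pairing (fun P => diag_poly b P n i)
          (fun s P => eta s (mean (diag_poly b P n))) W e.

Lemma eta_mean_cvg s P :
  norm_cvg (fun n => eta s (mean (diag_poly b P n))) (eta s (phi P)).
Proof.
apply: (norm_cvg_map (f := eta s)) (eta_bound s) (b_cvg P) => x y.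
exact: linearB.
Qed.

(** The means are replaced by their limits one at a time.  The factors on the
    left of the current one are collected in [c], whose power means must stay
    bounded. *)
Lemma pairing_mean_diff (c : forall n, 'I_n -> B) W e :
  tame_array (fun n i => cnorm (c n i)) ->
  (fun n => cnorm (mean (fun i : 'I_n =>
    c n i * (random_pairing i W e - diag_poly b (pair_poly W e) n i))))
    @ \oo --> (0 : R).
Proof.
have tameM := ideal_M (@tame_array_ideal R).
have polyT P := diag_poly_ideal P (@tame_array_ideal R) b_tame.
elim/(@pairing_ind (bpoly B T) S): W c => [c _|[P s] c _|].
- apply: cvg_near_cst; near=> n; rewrite /mean big1 ?scaler0 ?cnorm0 // => i _.
  by rewrite subrr mulr0.
- apply: cvg_near_cst; near=> n; rewrite /mean big1 ?scaler0 ?cnorm0 // => i _.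
  by rewrite /random_pairing /diag_poly /= subrr mulr0.
move=> [P s] [P' s'] W IH c ct.
rewrite /random_pairing /=; case: asboolP => _; last first.
  apply: cvg_near_cst; near=> n; rewrite /mean big1 ?scaler0 ?cnorm0 // => i _.
  by rewrite /diag_poly /= subrr mulr0.
pose em n := eta s (mean (diag_poly b P' n)); pose el := eta s (phi P').
pose c' n (i : 'I_n) := c n i * diag_poly b P n i * em n.
have emC := eta_mean_cvg s P'; rewrite -/em -/el in emC.
have em_tame : tame_array (fun n (i : 'I_n) => cnorm (em n)).
  apply: (@tame_array_near_bounded _ _ (cnorm el + 1)); near=> n => i.
  rewrite ger0_norm ?cnorm_ge0 //.
  rewrite -(subrK el (em n)) addrC (le_trans (cnormD _ _)) // lerD2l ltW //.
  by near: n; exact: ((norm_cvgP _ _).1 emC).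
have c'_tame : tame_array (fun n (i : 'I_n) => cnorm (c' n i)).
  apply: (ideal_le (@tame_array_ideal R) _
    (tameM _ _ (tameM _ _ ct (polyT P)) em_tame)) => n i.
  rewrite !ger0_norm ?mulr_ge0 ?cnorm_ge0 // (le_trans (cnormM _ _)) //.
  by rewrite ler_wpM2r ?cnorm_ge0 // cnormM.
have := tameM _ _ (tameM _ _ ct (polyT P)) (polyT (pair_poly W e)).
move=> /(_ 1%N)[C rC].
have h : (fun n => cnorm (mean (fun i : 'I_n => c' n i *
      (random_pairing i W e - diag_poly b (pair_poly W e) n i))) +
    C * cnorm (em n - el)) @ \oo --> (0 : R).
  rewrite -(addr0 0); apply: cvgD; first exact: IH.
  by rewrite -(mulr0 C); apply: cvgM => //; exact: cvg_cst.
apply: (squeeze_cvgr _ (cvg_cst 0) h); near=> n; rewrite cnorm_ge0 /=.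
(* c P em X - c P el Y = (c P em) (X - Y) + c P (em - el) Y *)
have -> : mean (fun i : 'I_n => c n i *
   (diag_poly b P n i * eta s (mean (diag_poly b P' n)) *
    pairing (fun P0 => diag_poly b P0 n i)
            (fun s0 P0 => eta s0 (mean (diag_poly b P0 n))) W e -
    diag_poly b (BMul (BMul P (BConst el)) (pair_poly W e)) n i)) =
  mean (fun i : 'I_n => c' n i *
      (random_pairing i W e - diag_poly b (pair_poly W e) n i)) +
  mean (fun i : 'I_n => c n i * diag_poly b P n i * (em n - el) *
      diag_poly b (pair_poly W e) n i).
  rewrite /mean -scalerDr -big_split; congr (_ *: _); apply: eq_bigr => i _.
  rewrite /= /c' /random_pairing -/(em n).
  rewrite -[diag_poly b (BMul _ _) n i]/(diag_poly b P n i * el *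
    diag_poly b (pair_poly W e) n i).
  by rewrite !mulrBr !mulrBl !mulrA addrA subrK.
rewrite (le_trans (cnormD _ _)) // lerD2l (le_trans (cnorm_mean_le _)) //.
apply: le_trans (_ : n%:R^-1 * \sum_(i < n) (`|cnorm (c n i) *
  cnorm (diag_poly b P n i) * cnorm (diag_poly b (pair_poly W e) n i)| ^+ 1
  * cnorm (em n - el)) <= _).
  apply: mean_le => i; rewrite expr1 ger0_norm ?mulr_ge0 ?cnorm_ge0 //.
  rewrite (le_trans (cnormM _ _)) // [leRHS]mulrAC ler_wpM2r ?cnorm_ge0 //.
  rewrite (le_trans (cnormM _ _)) // ler_wpM2r ?cnorm_ge0 //.
  exact: cnormM.
rewrite -mulr_suml mulrA ler_wpM2r ?cnorm_ge0 //.
by near: n.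
Unshelve. all: end_near. Qed.

Lemma mean_pairing_cvg W e :
  norm_cvg (fun n => mean (fun i : 'I_n => random_pairing i W e))
           (phi (pair_poly W e)).
Proof.
have one_tame : tame_array (fun n (i : 'I_n) => cnorm (1 : B)).
  exact: (ideal_cst (@tame_array_ideal R)).
have h : (fun n => cnorm (mean (fun i : 'I_n => 1 *
      (random_pairing i W e - diag_poly b (pair_poly W e) n i))) +
    cnorm (mean (diag_poly b (pair_poly W e) n) - phi (pair_poly W e)))
    @ \oo --> (0 : R).
  by rewrite -(addr0 0); apply: cvgD;
    [exact: pairing_mean_diff|exact: b_cvg].
apply: (norm_cvg_le h); near=> n.
rewrite (le_trans (cnorm_le_dist _ (mean (diag_poly b (pair_poly W e) n)) _)) //.
rewrite lerD2r /mean -scalerBr -sumrB.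
by under [in leRHS]eq_bigr do rewrite mul1r.
Unshelve. all: end_near. Qed.

End MainTerm.

(** * The joint limit *)

Lemma pairing_map (X Y S : Type) (U : pzRingType) (g : Y -> U) (f : S -> Y -> U)
    (h : X -> Y) W e :
  pairing g f [seq (h w.1, w.2) | w <- W] (h e) =
  pairing (g \o h) (fun s => f s \o h) W e.
Proof.
elim/(@pairing_ind X S): W => [|[P s]|[P s] [P' s'] W IH] //=.
by rewrite IH.
Qed.

Section Words.
Context (R : realType) (B : cstarAlgType R) (S T : Type).

Fixpoint bpoly_map (I J : Type) (h : I -> J) (p : bpoly B I) : bpoly B J :=
  match p with
  | BConst b => BConst b
  | BVar i => BVar (h i)
  | BVarStar i => BVarStar (h i)
  | BAdd p q => BAdd (bpoly_map h p) (bpoly_map h q)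
  | BMul p q => BMul (bpoly_map h p) (bpoly_map h q)
  end.

Lemma beval_map (I J : Type) (h : I -> J) (U : pzRingType) (inj : B -> U) st x p :
  beval inj st x (bpoly_map h p) = beval inj st (x \o h) p.
Proof. by elim: p => //= p -> q ->. Qed.

Definition word : Type := seq (bpoly B T * S) * bpoly B T.

Fixpoint word_poly (W : seq (bpoly B T * S)) (e : bpoly B T) : bpoly B (S + T) :=
  if W is (P, s) :: W' then
    BMul (BMul (bpoly_map inr P) (BVar (inl s))) (word_poly W' e)
  else bpoly_map inr e.

Definition word_mull (e : bpoly B T) (w : word) : word :=
  if w.1 is (P, s) :: W then ((BMul e P, s) :: W, w.2) else ([::], BMul e w.2).

Definition word_mul (w w' : word) : word :=
  let w'' := word_mull w.2 w' in (w.1 ++ w''.1, w''.2).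

(** A polynomial as a sum of words, in which the adjoints of the random matrices
    are removed by selfadjointness.  The constants 1 fill the places around an
    isolated variable. *)
Fixpoint normal_form (p : bpoly B (S + T)) : seq word :=
  match p with
  | BConst b => [:: ([::], BConst b)]
  | BVar (inl s) | BVarStar (inl s) => [:: ([:: (BConst 1, s)], BConst 1)]
  | BVar (inr t) => [:: ([::], BVar t)]
  | BVarStar (inr t) => [:: ([::], BVarStar t)]
  | BAdd p q => normal_form p ++ normal_form q
  | BMul p q => [seq word_mul w w' | w <- normal_form p, w' <- normal_form q]
  end.

Lemma normal_formE (U : pzRingType) (inj : B -> U) (st : U -> U) (x : S + T -> U) p :
  inj 1 = 1 -> (forall s, st (x (inl s)) = x (inl s)) ->
  beval inj st x p =
  \sum_(w <- normal_form p) beval inj st x (word_poly w.1 w.2).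
Proof.
move=> inj1 stx.
have mullE e w : beval inj st x (word_poly (word_mull e w).1 (word_mull e w).2) =
    beval inj st x (bpoly_map inr e) * beval inj st x (word_poly w.1 w.2).
  by case: w => [[|[P s] W] e'] //=; rewrite !mulrA.
have mulE w w' : beval inj st x (word_poly (word_mul w w').1 (word_mul w w').2) =
    beval inj st x (word_poly w.1 w.2) * beval inj st x (word_poly w'.1 w'.2).
  case: w => W e; rewrite /word_mul /=; elim: W => [|[P s] W IH] /=.
    exact: mullE.
  by rewrite IH !mulrA.
elim: p => [c|[s|t]|[s|t]|p IHp q IHq|p IHp q IHq] /=; rewrite ?big_seq1 //=.
- by rewrite inj1 mul1r mulr1.
- by rewrite inj1 mul1r mulr1 stx.
- by rewrite big_cat IHp IHq.
- rewrite IHp IHq big_allpairs_dep big_distrl; apply: eq_bigr => w _.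
  by rewrite big_distrr; apply: eq_bigr => w' _; rewrite mulE.
Qed.

End Words.

Section Limit.
Context (R : realType) (B : cstarAlgType R) (A : bprobSpace B) (S T : Type).
Context (a : forall n : nat, S -> 'I_n -> 'I_n -> A).
Arguments a : clear implicits.
Context (eta : S -> {linear B -> B}).
Hypothesis Y1 : forall n s (i j : 'I_n), a n s i j = star (a n s j i).
Hypothesis Y2 : forall n s (i j : 'I_n), bexp A (a n s i j) = 0.
Hypothesis Y3 : forall n s (i j : 'I_n) (b : B),
  bexp A (a n s i j * binj A b * a n s j i) = (n%:R^-1 : R[i]) *: eta s b.
Hypothesis Y4 : forall m : nat, (0 < m)%N -> exists2 M : R, 0 < M &
  forall (n : nat) (b : nat -> B) (s : nat -> S) (i j : nat -> 'I_n),
    cnorm (bexp A ((\prod_(k < m.-1)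
                      (a n (s k) (i k) (j k) * binj A (b k))) *
                   a n (s m.-1) (i m.-1) (j m.-1)))
    <= M * (n%:R `^ (- (m%:R / 2))) * \prod_(k < m.-1) cnorm (b k).
Hypothesis Y5 : forall n : nat, boolean_independent
  (fun q : S * {ij : 'I_n * 'I_n | (ij.1 <= ij.2)%N} =>
     a n q.1 (val q.2).1 (val q.2).2).

(** Matrices of size 1 show that the covariance maps are uniformly bounded. *)
Lemma eta_bounded : exists2 H : R, 1 <= H &
  forall s c, cnorm (eta s c) <= H * cnorm c.
Proof.
have [M M0 hM] := Y4 (isT : (0 < 2)%N); exists (1 + M); first by rewrite lerDl ltW.
move=> s c.
have := hM 1%N (fun=> c) (fun=> s) (fun=> ord0) (fun=> ord0).
rewrite !big_ord1 Y3 invr1 scale1r powR1 mulr1 => /le_trans; apply.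
by rewrite ler_wpM2r ?cnorm_ge0 // lerDr.
Qed.

Context (b : forall n : nat, T -> 'I_n -> B) (phi : bpoly B T -> B).
Arguments b : clear implicits.
Hypothesis b_small : forall t, small_array (fun n i => cnorm (b n t i)).
Hypothesis b_tame : forall t, tame_array (fun n i => cnorm (b n t i)).

Definition Zmx n s : 'M[A]_n := \matrix_(i, j) a n s i j.
Definition Dmx n t : 'M[A]_n := map_mx (binj A) (diag_mx (\row_i b n t i)).

Hypothesis D_cvg : weak_cvg (fun n => mx_law (@Dmx n)) phi.

Lemma beval_diag n P :
  beval (fun c => (binj A c)%:M) (@mxstar R A n) (@Dmx n) P =
  diagA A (diag_poly b P n).
Proof.
elim: P => [c|t|t|P IHP Q IHQ|P IHP Q IHQ] /=.
- by apply/matrixP => i j; rewrite !mxE.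
- apply/matrixP => i j; rewrite !mxE.
  by case: eqP; rewrite ?mulr1n ?mulr0n ?rmorph0.
- apply/matrixP => i j; rewrite !mxE eq_sym.
  case: eqP => [->|]; rewrite ?mulr1n ?mulr0n ?rmorph0 ?star0 //.
  by rewrite /diag_poly /= binj_star.
- rewrite IHP IHQ; apply/matrixP => i j; rewrite !mxE /diag_poly /= rmorphD.
  by rewrite mulrnDl.
- rewrite IHP IHQ -[LHS]/(_ *m _) mul_diag_mx; apply/matrixP => i j.
  by rewrite !mxE /diag_poly /= rmorphM mulrnAr.
Qed.

Lemma diag_mean_cvg P : norm_cvg (fun n => mean (diag_poly b P n)) (phi P).
Proof.
apply: near_norm_cvg (D_cvg P); near=> n.
rewrite /mx_law beval_diag /mx_bexp; congr (_ *: _); apply: eq_bigr => i _.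
by rewrite !mxE eqxx mulr1n bexp_binj.
Unshelve. all: end_near. Qed.

Lemma beval_word n W e :
  beval (fun c => (binj A c)%:M) (@mxstar R A n)
    (family_sum (@Zmx n) (@Dmx n)) (word_poly W e) =
  word_mx (a n) [seq (diag_poly b w.1 n, w.2) | w <- W] (diag_poly b e n).
Proof.
elim: W => [|[P s] W IH] /=.
  by rewrite beval_map beval_diag.
by rewrite beval_map beval_diag IH.
Qed.

Lemma bounded_word_near (W : seq (bpoly B T * S)) m : (0 < m)%N ->
  \forall n \near \oo, bounded_word (n%:R `^ (m%:R^-1))
    [seq (diag_poly b w.1 n, w.2) | w <- W].
Proof.
move=> m0; elim: W => [|[P s] W IH]; first by near=> n.
have Ps := diag_poly_ideal P (@small_array_ideal R) b_small.
near=> n; split; last by near: n.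
have Pn : forall i : 'I_n, `|cnorm (diag_poly b P n i)| <= n%:R `^ m%:R^-1.
  by near: n; exact: small_array_root Ps.
by move=> i; rewrite (le_trans _ (Pn i)) // ler_norm.
Unshelve. all: end_near. Qed.

Lemma word_cvg W e :
  norm_cvg (fun n => mx_law (family_sum (@Zmx n) (@Dmx n)) (word_poly W e))
           (phi (pair_poly eta phi W e)).
Proof.
have [H H1 etaH] := eta_bounded.
have mainC := mean_pairing_cvg etaH b_tame diag_mean_cvg W e.
case: W => [|[P s] W] in mainC *.
  apply: near_norm_cvg mainC; near=> n.
  rewrite /mx_law beval_word mx_bexp_word; congr (_ *: _).
  by apply: eq_bigr => i _ /=; rewrite eqxx bexp_binj.
pose m := size W; have [M M0 hM] := Y4 (ltn0Sn m).
(* With this exponent, [m + 2] entries contribute at most n^(1/4), against the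
   gain of n^(1/2) in the estimate. *)
pose q := (4 * m.+2)%N; have q0 : (0 < q)%N by [].
pose K n : R := n%:R `^ q%:R^-1; pose u n : R := Num.sqrt n%:R.
have v0 : (fun n => K n ^+ m.+2 / u n) @ \oo --> (0 : R).
  apply: cvg_fourth_root; near=> n.
  have n0 : (0 < n)%N by near: n; exact: nbhs_infty_gt.
  split; first by rewrite divr_ge0 ?exprn_ge0 ?powR_ge0 ?sqrtr_ge0.
  rewrite expr_div_n -exprM mulnC -/q /K -powR_mulrn ?powR_ge0 // -powRrM.
  rewrite mulVf ?powRr1 ?pnatr_eq0 // /u (exprM _ 2 2) sqr_sqrtr ?ler0n //.
  by rewrite expr2 invfM mulrA mulfV ?mul1r // pnatr_eq0 -lt0n.
pose C := 2 ^+ m * (M + H ^+ m.+1).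
have {}v0 : (fun n => C * (K n ^+ m.+2 / u n)) @ \oo --> (0 : R).
  by rewrite -(mulr0 C); apply: cvgM v0; exact: cvg_cst.
have h : (fun n => C * (K n ^+ m.+2 / u n) +
    cnorm (mean (fun i : 'I_n => pairing (fun P => diag_poly b P n i)
       (fun s P => eta s (mean (diag_poly b P n))) ((P, s) :: W) e) -
       phi (pair_poly eta phi ((P, s) :: W) e))) @ \oo --> (0 : R).
  by rewrite -(addr0 0); apply: cvgD.
have e_root := small_array_root q0
  (diag_poly_ideal e (@small_array_ideal R) b_small).
apply: (norm_cvg_le h); near=> n.
rewrite (le_trans (cnorm_le_dist _ (mean (fun i : 'I_n =>
  pairing (fun P => diag_poly b P n i)
       (fun s P => eta s (mean (diag_poly b P n))) ((P, s) :: W) e)) _)) //.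
rewrite lerD2r /mx_law beval_word.
have n1 : (1 <= n)%N by near: n; exact: nbhs_infty_gt.
have u1 : 1 <= u n by rewrite -[leLHS]sqrtr1 ler_wsqrtr // ler1n.
have u2 : u n ^+ 2 = n%:R by rewrite sqr_sqrtr.
have := @mx_bexp_word_estimate _ _ _ _ _ (a n) eta (u n) u1 u2 (@Y1 n) (@Y2 n)
  (@Y3 n) (@Y5 n) (K n) M H m
  [seq (diag_poly b w.1 n, w.2) | w <- (P, s) :: W] (diag_poly b e n).
have -> : mean (fun i : 'I_n => pairing (fun d : 'I_n -> B => d i)
    (fun s d => eta s (mean d))
    [seq (diag_poly b w.1 n, w.2) | w <- (P, s) :: W] (diag_poly b e n)) =
  mean (fun i : 'I_n => pairing (fun P => diag_poly b P n i)
       (fun s P => eta s (mean (diag_poly b P n))) ((P, s) :: W) e).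
  congr (_ *: _); apply: eq_bigr => i _.
  exact: (pairing_map (fun d : 'I_n -> B => d i) (fun s d => eta s (mean d))
    (fun P => diag_poly b P n)).
apply => //.
- exact: powR_ge0.
- exact: ltW.
- by rewrite /= size_map.
- move=> c s' i j; have := hM n c s' i j; congr (_ <= M * _ * _).
  rewrite powRN; congr (_^-1).
  by rewrite mulrC powRrM powR12_sqrt // powR_mulrn ?sqrtr_ge0.
- by near: n; exact: bounded_word_near.
- move=> i; rewrite (le_trans (ler_norm _)) //.
  have hn : forall i : 'I_n, `|cnorm (diag_poly b e n i)| <= K n by near: n.
  exact: hn.
Unshelve. all: end_near. Qed.

Lemma mx_law_normal_form n p :
  mx_law (family_sum (@Zmx n) (@Dmx n)) p =
  \sum_(w <- normal_form p)
    mx_law (family_sum (@Zmx n) (@Dmx n)) (word_poly w.1 w.2).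
Proof.
rewrite /mx_law normal_formE /=.
- rewrite /mx_bexp -scaler_sumr; congr (_ *: _); rewrite exchange_big /=.
  by apply: eq_bigr => i _; rewrite summxE linear_sum.
- by rewrite rmorph1.
- by move=> s; apply/matrixP => i j; rewrite !mxE -Y1.
Qed.

(** The limit law is read off the words of the normal form by [word_cvg] and
    realized by [weak_limit_realization].  Dimension 0 is skipped, as there the
    matrices do not form a B-valued probability space. *)
Lemma joint_limit : exists (L : bprobSpace B) (Z : S -> L) (D : T -> L),
  [/\ forall s, star (Z s) = Z s, law D =1 phi,
      weak_cvg (fun n => mx_law (family_sum (@Zmx n) (@Dmx n)))
               (law (family_sum Z D))
    & forall W e,
      law (family_sum Z D) (word_poly W e) =
      law D (pair_poly eta (law D) W e)].
Proof.
pose mu p := \sum_(w <- normal_form p) phi (pair_poly eta phi w.1 w.2).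
have mu_cvg : weak_cvg (fun n => mx_law (family_sum (@Zmx n) (@Dmx n))) mu.
  move=> p; rewrite /mu; under eq_cvg do rewrite mx_law_normal_form.
  apply: norm_cvg_sum => w; exact: word_cvg.
have mu_lim p l : norm_cvg (fun n => mx_law (family_sum (@Zmx n) (@Dmx n)) p) l ->
    mu p = l.
  exact: norm_limit_unique (mu_cvg p).
have mu_cvgS : weak_cvg (fun n => @law R B (mx_bprobSpace A n) _
    (family_sum (@Zmx n.+1) (@Dmx n.+1))) mu.
  by move=> p; have := mu_cvg p; rewrite /norm_cvg -cvg_shiftS.
have [L [X [XL Xeq]]] := weak_limit_realization mu_cvgS.
have XE : family_sum (X \o inl) (X \o inr) = X by apply: funext => -[].
have Dphi : law (X \o inr) =1 phi.
  move=> P; rewrite /law -beval_map -[LHS]/(law X _) XL; apply: mu_lim.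
  apply: near_norm_cvg (D_cvg P); near=> n.
  by rewrite /mx_law beval_map.
exists L, (X \o inl), (X \o inr); rewrite XE; split=> //.
- move=> s; apply: (Xeq (BVarStar (inl s)) (BVar (inl s))) => n /=.
  by apply/matrixP => i j; rewrite !mxE -Y1.
- by move=> p; rewrite XL; exact: mu_cvg.
- move=> W e; have -> : law (X \o inr) = phi by exact: funext.
  by rewrite XL; apply: mu_lim; exact: word_cvg.
Unshelve. all: end_near. Qed.

End Limit.

(** * Boolean cumulants from moments *)

Definition paired (S : Type) (m : nat) (s : nat -> S) : Prop :=
  ~~ odd m /\ le_ker (nseq m./2 2%N) s.

Lemma le_ker_nseq2 (S : Type) h (s : nat -> S) :
  le_ker (nseq h 2%N) s <-> forall k, (k < h)%N -> s k.*2 = s k.*2.+1.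
Proof.
have idx k i : (i < k.*2)%N -> reshape_index (nseq k 2%N) i = i./2.
  elim: k i => [|k IH] [|[|i]] // ik.
  by rewrite /reshape_index /= in IH *; rewrite subn2 /= IH.
have sz : sumn (nseq h 2%N) = h.*2 by rewrite sumn_nseq mul2n.
rewrite /le_ker sz; split=> [sk k kh|sk p q ph qh].
  have k1 : (k.*2.+1 < h.*2)%N by rewrite -doubleS leq_double in kh *.
  by apply: sk; rewrite ?idx ?(ltnW k1) //= ?uphalf_double ?doubleK.
rewrite !idx // => pq.
have e r : (r < h.*2)%N -> s r = s r./2.*2.
  move=> rh; rewrite -[in LHS](odd_double_half r); case: odd => //=.
  by rewrite -sk // -divn2 ltn_divLR // muln2.
by rewrite (e p) // (e q) // pq.
Qed.

Section PairingFunction.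
Context (X S : Type) (U : pzRingType) (g : X -> U) (f : S -> X -> U).

(** [pairing] as the product over the pairs that appears in the limit moments. *)
Lemma pairing_mkseq m (x : nat -> X) (s : nat -> S) :
  (paired m s -> pairing g f (mkseq (fun k => (x k, s k)) m) (x m) =
     (\prod_(k < m./2) (g (x k.*2) * f (s k.*2) (x k.*2.+1))) * g (x m)) /\
  (~ paired m s -> pairing g f (mkseq (fun k => (x k, s k)) m) (x m) = 0).
Proof.
have shift T (h : nat -> T) k : mkseq h k.+2 = [:: h 0%N, h 1%N & mkseq (fun i => h i.+2) k].
  rewrite /mkseq /= -[2%N]/(2 + 0)%N iotaDl -map_comp; congr [:: _, _ & _].
rewrite /paired; have [k] := ubnP m; elim: k m x s => // k IH [|[|m]] x s mk.
- split=> [_|[]]; first by rewrite /= big_ord0 mul1r.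
  by split=> // p q; rewrite ltn0.
- by split=> [[]|].
rewrite shift /= negbK; have mk' : (m < k)%N by exact: ltnW.
have [IHp IHn] := IH m (fun i => x i.+2) (fun i => s i.+2) mk'.
rewrite -[2%N :: _]/(nseq m./2.+1 2%N).
case: asboolP => s01; last first.
  split=> // -[_ /le_ker_nseq2 /(_ 0%N isT)] //.
have le_shift : le_ker (nseq m./2.+1 2%N) s <-> le_ker (nseq m./2 2%N) (fun i => s i.+2).
  rewrite !le_ker_nseq2; split=> h i im; first exact: (h i.+1).
  by case: i im => // i im; exact: (h i).
split=> [[om /le_shift h]|h].
  by rewrite IHp // big_ord_recl /= mulrA.
by rewrite IHn ?mulr0 // => -[om /le_shift h']; apply: h.
Qed.

End PairingFunction.

Lemma pairing_odd (X S : Type) (U : pzRingType) (g : X -> U) (f : S -> X -> U) W e :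
  odd (size W) -> pairing g f W e = 0.
Proof.
elim/(@pairing_ind X S): W => [|[P s]|[P s] [P' s'] W IH] //=.
by rewrite negbK => /IH ->; rewrite mulr0 if_same.
Qed.

Section Bernoulli.
Context (R : realType) (B : cstarAlgType R) (A : bprobSpace B) (S : Type).
Context (Z : S -> A) (eta : S -> B -> B).
Implicit Types (L : seq (B * S)) (e : B).

Definition moment_word L e : A :=
  foldr (fun w x => binj A w.1 * Z w.2 * x) (binj A e) L.

Hypothesis Z_star : forall s, star (Z s) = Z s.
Hypothesis Z_moments : forall L e, L <> [::] ->
  bexp A (moment_word L e) = pairing id eta L e.

(** The arguments of the Boolean cumulants, as a recursive list: its truncations
    and its products by elements of [B] on the left are again of this form. *)
Fixpoint moment_args L e : seq A :=
  match L with
  | [::] => [::]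
  | [:: (b, s)] => [:: binj A b * Z s * binj A e]
  | (b, s) :: L' => binj A b * Z s :: moment_args L' e
  end.

Lemma moment_args_cons b s w L e :
  moment_args ((b, s) :: w :: L) e = binj A b * Z s :: moment_args (w :: L) e.
Proof. by []. Qed.

Lemma size_moment_args L e : size (moment_args L e) = size L.
Proof. by elim: L => // -[b s] [|w L] //= ->. Qed.

Lemma prod_moment_args L e : L <> [::] ->
  \prod_(x <- moment_args L e) x = moment_word L e.
Proof.
elim: L => // -[b s] [|w L] IH _; first by rewrite big_seq1.
by rewrite moment_args_cons big_cons IH.
Qed.

Definition mul_first (v : B) L : seq (B * S) :=
  if L is (b, s) :: L' then (v * b, s) :: L' else [::].

Lemma mul_head_moment_args v L e :
  mul_head v (moment_args L e) = moment_args (mul_first v L) e.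
Proof. by case: L => // -[b s] [|w L] /=; rewrite rmorphM !mulrA. Qed.

Lemma drop_moment_args r L e : drop r (moment_args L e) = moment_args (drop r L) e.
Proof.
elim: r L => [|r IH] L; first by rewrite !drop0.
case: L => [|[b s] [|w L]] //.
exact: (IH (w :: L)).
Qed.

Lemma take_moment_args r L e : (r < size L)%N ->
  take r (moment_args L e) = moment_args (take r L) 1.
Proof.
elim: r L => [|r IH] L; first by rewrite !take0.
case: L => [|[b s] [|w L]] // rL.
rewrite -[LHS]/(_ :: take r (moment_args (w :: L) e)) IH //; case: r rL {IH} => [|r] rL //=.
by rewrite rmorph1 mulr1.
Qed.

Lemma pairing_mul_first v L e : L <> [::] ->
  pairing id eta (mul_first v L) e = v * pairing id eta L e.
Proof.
case: L => [//|[b s] [|[b' s'] L]] _ /=; first by rewrite mulr0.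
by case: asboolP => _; rewrite ?mulr0 // !mulrA.
Qed.

Definition pair_cumulant L e : B :=
  if size L == 2%N then pairing id eta L e else 0.

(** If [rho] vanishes except on pairs, where it is [pairing], then its extension
    to an interval partition is [pairing] for the pair partition and 0 for all
    others: the value of each block is absorbed by the next argument. *)
Lemma multi_ext_moment_args (rho : seq A -> B) c L e :
  (forall L' e', size L' \in c -> L' <> [::] ->
     rho (moment_args L' e') = pair_cumulant L' e') ->
  0%N \notin c -> size L = sumn c -> L <> [::] ->
  multi_ext rho c (moment_args L e) =
  if all (pred1 2%N) c then pairing id eta L e else 0.
Proof.
elim: c L => [|r c IH] L hrho c0 sL Ln.
  by move: sL => /size0nil.
case: c IH hrho c0 sL => [|r' c] IH hrho c0 sL.
  rewrite /= addn0 in sL *; rewrite hrho ?sL ?mem_head //.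
  by rewrite /pair_cumulant sL andbT.
have r0 : (0 < r)%N by rewrite lt0n eq_sym; move: c0; rewrite in_cons negb_or => /andP[].
have r'0 : (0 < r')%N.
  by rewrite lt0n eq_sym; move: c0; rewrite !in_cons !negb_or => /and3P[].
have rL : (r < size L)%N by rewrite sL /= -[ltnLHS]addn0 ltn_add2l addn_gt0 r'0.
have dn : drop r L <> [::].
  by move=> /(congr1 size); rewrite size_drop => /eqP; rewrite subn_eq0 leqNgt rL.
have tsz : size (take r L) = r by rewrite size_take rL.
have tn : take r L <> [::] by move=> h; move: tsz r0; rewrite h => <-.
rewrite -[LHS]/(multi_ext rho (r' :: c) (mul_head _ _)).
rewrite take_moment_args // drop_moment_args mul_head_moment_args.
rewrite hrho ?tsz ?mem_head // IH.
- rewrite pairing_mul_first //= /pair_cumulant tsz.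
  have [r2|] := eqVneq r 2%N; last by rewrite mul0r if_same.
  subst r; case: L {sL Ln IH} rL dn tsz tn => [|[b s] [|[b' s'] L]] //= _ _ _ _.
  case: ifP => // _; rewrite drop0.
  by case: asboolP => _; rewrite ?mul0r // take0 /= mulr1.
- by move=> L' e' L'c; apply: hrho; rewrite in_cons L'c orbT.
- by move: c0; rewrite in_cons negb_or => /andP[].
- by case: (drop r L) (size_drop r L) => [|[b s] L'] /= ->; rewrite sL addKn.
- by case: (drop r L) dn => [|[b s] L'].
Qed.

(** By induction the only interval partition other than the full one with a
    nonzero contribution is the pair partition, whose contribution is the whole
    moment.  So the cumulant is the moment minus itself, except at length 2,
    where the pair partition is the full one; at odd length there is no pair
    partition and the moment is 0. *)
Lemma bcumulant_moment_args L e : L <> [::] ->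
  bcumulant (moment_args L e) = pair_cumulant L e.
Proof.
have [m] := ubnP (size L); elim: m L e => // m IH L e Lm Ln.
have sz0 : (0 < size L)%N by case: L Ln {Lm}.
rewrite bcumulantE size_moment_args // prod_moment_args // Z_moments //.
set V := pairing id eta L e.
rewrite big_seq_cond (eq_bigr (fun c => if all (pred1 2%N) c then V else 0)); last first.
  move=> c /andP[cin cn]; apply: multi_ext_moment_args => //.
  - move=> L' e' L'c L'n; apply: IH => //.
    exact: leq_trans (intpart_part_lt cin cn L'c) Lm.
  - by move: cin; rewrite mem_intpart => /andP[].
  - by move: cin; rewrite mem_intpart => /andP[_ /eqP].
have all2 c : all (pred1 2%N) c -> sumn c = size L -> c = nseq (size L)./2 2%N.
  by move=> /all_pred1P ->; rewrite sumn_nseq mul2n => <-; rewrite doubleK.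
rewrite /pair_cumulant -/V; have [oL|eL] := boolP (odd (size L)).
  have -> : V = 0 by exact: pairing_odd.
  by rewrite big1 ?subr0 ?if_same // => c _; rewrite if_same.
have [L2|L2] := eqVneq (size L) 2%N.
  rewrite big1 ?subr0 // => c /andP[cin cn]; case: ifP => // /all2 c2.
  move: cin; rewrite mem_intpart => /andP[_ /eqP /c2 cE].
  by rewrite cE L2 eqxx in cn.
set c0 := nseq (size L)./2 2%N.
have c0in : c0 \in intpart (size L).
  rewrite mem_intpart mem_nseq andbF /= sumn_nseq mul2n.
  by rewrite -{2}(odd_double_half (size L)) (negPf eL) add0n.
have c0n : c0 != [:: size L].
  apply: contra_neq L2 => h.
  by have := mem_head (size L) [::]; rewrite -h mem_nseq => /andP[_ /eqP].
rewrite -big_seq_cond -big_filter (bigD1_seq c0) ?filter_uniq ?intpart_uniq //=; last first.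
  by rewrite mem_filter c0n.
rewrite big_seq_cond big1 ?addr0 => [|c /andP[]].
  by rewrite /c0 all_pred1_nseq subrr.
rewrite mem_filter mem_intpart => /andP[_ /andP[_ /eqP cs]] cc0.
by case: ifP => // /all2 /(_ cs) cE; rewrite cE eqxx in cc0.
Qed.

Lemma bernoulli_args_moment_args m (s : nat -> S) (b : nat -> B) :
  bernoulli_args Z m s b = moment_args (mkseq (fun k => (b k, s k)) m) (b m).
Proof.
have shift T (h : nat -> T) k : mkseq h k.+1 = h 0%N :: mkseq (fun i => h i.+1) k.
  by rewrite /mkseq /= -[1%N]/(1 + 0)%N iotaDl -map_comp.
rewrite /bernoulli_args; elim: m s b => // m IH s b; rewrite !shift.
case: m IH => [//|m] IH.
rewrite -[LHS]/((_ * _ * 1) :: mkseq (fun i => binj A (b i.+1) * Z (s i.+1) *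
  (if i.+1 == m.+1 then binj A (b m.+2) else 1)) m.+1).
rewrite mulr1 (IH (fun k => s k.+1) (fun k => b k.+1)).
by rewrite -moment_args_cons.
Qed.

Lemma boolean_bernoulli_of_moments : boolean_bernoulli Z.
Proof.
split=> // m s b c m0 cin nc; rewrite bernoulli_args_moment_args.
set L := mkseq _ _; have sL : size L = m by rewrite size_mkseq.
have Ln : L <> [::] by move=> h; rewrite h in sL; rewrite -sL in m0.
move: cin; rewrite mem_intpart => /andP[c0 /eqP cm].
rewrite multi_ext_moment_args ?sL //; last first.
  by move=> L' e' _; exact: bcumulant_moment_args.
case: ifP => // c2; apply: (proj2 (pairing_mkseq id eta m b s)) => -[om kers].
apply: nc; split=> //; suff -> : c = nseq m./2 2%N by [].
move: cm; move/all_pred1P: c2 => ->; rewrite sumn_nseq mul2n => <-.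
by rewrite doubleK.
Qed.


End Bernoulli.

(** * Moments of the limit variables *)

Section MomentsOfWords.
Context (R : realType) (B : cstarAlgType R) (A : bprobSpace B) (S T : Type).
Context (Z : S -> A) (D : T -> A) (eta : S -> {linear B -> B}).

Hypothesis Z_star : forall s, star (Z s) = Z s.
Hypothesis word_law : forall W e,
  law (family_sum Z D) (word_poly W e) = law D (pair_poly eta (law D) W e).

Lemma bernoulli_of_word_law : boolean_bernoulli Z.
Proof.
apply: (@boolean_bernoulli_of_moments _ _ _ _ _ (fun s c => eta s c)) => // L e _.
have -> : moment_word Z L e = beval (binj A) star (family_sum Z D)
    (word_poly [seq (BConst w.1, w.2) | w <- L] (BConst e)).
  by elim: L => //= -[c s] L ->.
rewrite -[LHS]/(law _ _) word_law -[RHS](bexp_binj A); congr (bexp _ _).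
rewrite beval_pair_poly ?rmorph0 //.
elim/(@pairing_ind B S): L => [|[c s]|[c s] [c' s'] L IH] //=.
  by rewrite rmorph0.
case: asboolP => _; last by rewrite rmorph0.
by rewrite IH !rmorphM /law /= bexp_binj.
Qed.

Lemma gen_algebra_poly u : gen_algebra D u ->
  exists p, u = beval (binj A) star D p.
Proof.
move=> /(_ [set u | exists p, u = beval (binj A) star D p]); apply; split.
  split.
  - by exists (BConst 1); rewrite /= rmorph1.
  - by move=> v w [p ->] [q ->]; exists (BAdd p q).
  - by move=> v w [p ->] [q ->]; exists (BMul p q).
  - by move=> c v [p ->]; exists (BMul (BConst c%:A) p);
      rewrite /= linearZ rmorph1 mulr_algl.
by move=> v [[c _ <-]|[t _ <-]]; [exists (BConst c)|exists (BVar t)].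
Qed.

Lemma beval_word_mkseq m (p : nat -> bpoly B T) (s : nat -> S) :
  beval (binj A) star (family_sum Z D)
    (word_poly (mkseq (fun k => (p k, s k)) m) (p m)) =
  (\prod_(k < m) (beval (binj A) star D (p k) * Z (s k))) *
  beval (binj A) star D (p m).
Proof.
elim: m p s => [|m IH] p s.
  by rewrite /= beval_map big_ord0 mul1r.
rewrite /mkseq /= -[1%N]/(1 + 0)%N iotaDl -map_comp beval_map.
by rewrite (IH (fun k => p k.+1) (fun k => s k.+1)) big_ord_recl !mulrA.
Qed.

Lemma moments_of_word_law m (s : nat -> S) (P : nat -> A) :
  (forall k, (k <= m)%N -> gen_algebra D (P k)) ->
  let lhs := bexp A ((\prod_(k < m) (P k * Z (s k))) * P m) in
  (paired m s -> lhs = bexp A ((\prod_(k < m./2)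
     (P k.*2 * binj A (eta (s k.*2) (bexp A (P k.*2.+1))))) * P m)) /\
  (~ paired m s -> lhs = 0).
Proof.
move=> PD lhs.
have /choice[p pP] : forall k, exists p, (k <= m)%N -> P k = beval (binj A) star D p.
  move=> k; have [km|km] := boolP (k <= m)%N; last by exists (BConst 0).
  by have [p ->] := gen_algebra_poly (PD k km); exists p.
have lhsE : lhs = bexp A (pairing (beval (binj A) star D)
    (fun s P => binj A (eta s (law D P))) (mkseq (fun k => (p k, s k)) m) (p m)).
  rewrite -beval_pair_poly ?rmorph0 // -[RHS]word_law /law beval_word_mkseq.
  rewrite /lhs (pP m) //; congr (bexp _ (_ * _)); apply: eq_bigr => k _.
  by rewrite -pP // ltnW.
have [hp hn] := pairing_mkseq (beval (binj A) star D)
  (fun s P => binj A (eta s (law D P))) m p s.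
rewrite lhsE; split=> [/hp ->|/hn ->]; last by rewrite linear0.
rewrite (pP m) //; congr (bexp _ (_ * _)); apply: eq_bigr => k _.
have km : (k.*2.+1 < m)%N.
  by rewrite -doubleS -geq_half_double.
by rewrite !pP ?(ltnW km) // ltnW // ltnW.
Qed.

End MomentsOfWords.

(** * The conditions on the diagonal matrices *)

Section DiagonalNorm.
Context (R : realType) (B : cstarAlgType R).

(** The norm is tested on the [i]-th vector of the standard basis. *)
Lemma diag_norm_le n (d : 'I_n -> B) i :
  ((cnorm (d i))%:E <= mx_cstar_norm (diag_mx (\row_j d j)))%E.
Proof.
have col (c : 'I_n -> B) : (forall k, k != i -> c k = 0) ->
    colnorm (\col_k c k) = cnorm (c i).
  move=> c0; rewrite /colnorm (bigD1 i) //= big1 ?addr0 => [|k ki].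
    by rewrite !mxE cnorm_star sqrtr_sqr ger0_norm ?cnorm_ge0.
  by rewrite !mxE c0 // mulr0.
apply: ereal_sup_ubound; exists (\col_k (k == i)%:R : 'cV[B]_n).
  by rewrite /= col ?eqxx ?cnorm1 // => k /negPf ->.
congr (_%:E); rewrite mul_diag_mx.
rewrite -[RHS]mulr1 -[d i](mulr1).
transitivity (colnorm (\col_k (d k * (k == i)%:R) : 'cV[B]_n)).
  by congr colnorm; apply/matrixP => k l; rewrite !mxE.
by rewrite col ?eqxx // => [|k /negPf ->]; rewrite ?mulr0 // !mulr1.
Qed.

Lemma small_array_diag (d : forall n, 'I_n -> B) :
  (forall k : nat, (mx_cstar_norm (diag_mx (\row_i d n i)) ^+ k *
     (n%:R^-1)%:E)%E @[n --> \oo] --> 0%E) ->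
  small_array (fun n i => cnorm (d n i)).
Proof.
move=> dN k.
have lt1 : \forall n \near \oo, (mx_cstar_norm (diag_mx (\row_i d n i)) ^+ k *
     (n%:R^-1)%:E < 1)%E.
  have := dN k [set u | u < 1]%E; apply.
  by apply: open_ereal_lt'; rewrite lte01.
have powE n (i : 'I_n) :
    ((cnorm (d n i) ^+ k)%:E <= mx_cstar_norm (diag_mx (\row_i d n i)) ^+ k)%E.
  elim: k {dN lt1} => [|k IH]; first by rewrite expr0 expe0.
  rewrite exprS expeS EFinM lee_pmul ?lee_fin ?exprn_ge0 ?cnorm_ge0 //.
  exact: diag_norm_le.
near=> n; move=> i; rewrite ger0_norm ?cnorm_ge0 //.
have n0 : (0 < n)%N by near: n; exact: nbhs_infty_gt.
have : (mx_cstar_norm (diag_mx (\row_i d n i)) ^+ k * (n%:R^-1)%:E < 1)%E.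
  by near: n.
move=> h; have : ((cnorm (d n i) ^+ k)%:E * (n%:R^-1)%:E < 1)%E.
  by apply: le_lt_trans h; apply: lee_wpmul2r => //; rewrite lee_fin invr_ge0.
rewrite -EFinM lte_fin ltr_pdivrMr ?ltr0n // mul1r; exact: ltW.
Unshelve. all: end_near. Qed.

Lemma tame_array_limn_esup (d : forall n, 'I_n -> B) :
  (forall k : nat, (limn_esup (fun n : nat =>
     (n%:R^-1 * \sum_i cnorm (d n i) ^+ k)%:E) < +oo)%E) ->
  tame_array (fun n i => cnorm (d n i)).
Proof.
move=> ds k; have /ereal_inf_lt[_ [V V_near <-] Vy] := ds k.
exists (fine (ereal_sup [set (n%:R^-1 * \sum_(i < n) cnorm (d n i) ^+ k)%:E
  | n in V])).
near=> n.
have Vn : V n by near: n.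
have : ((n%:R^-1 * \sum_(i < n) cnorm (d n i) ^+ k)%:E <=
    ereal_sup [set (n%:R^-1 * \sum_(i < n) cnorm (d n i) ^+ k)%:E | n in V])%E.
  by apply: ereal_sup_ubound; exists n.
under [in X in _ -> X]eq_bigr do rewrite ger0_norm ?cnorm_ge0 //.
by case: (ereal_sup _) Vy.
Unshelve. all: end_near. Qed.

End DiagonalNorm.

(** * The theorem *)

Lemma mean_cst (R : realType) (B : cstarAlgType R) n (c : B) :
  (0 < n)%N -> mean (fun _ : 'I_n => c) = c.
Proof.
move=> n0; rewrite /mean sumr_const card_ord -[c *+ n](@scaler_nat R[i]) scalerA.
by rewrite mulVf ?scale1r // pnatr_eq0 -lt0n.
Qed.

Lemma weak_cvg_inl (R : realType) (B : cstarAlgType R) (A L : bprobSpace B)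
    (S T : Type) (X : forall n : nat, S -> 'M[A]_n)
    (Y : forall n : nat, T -> 'M[A]_n) (Z : S -> L) (D : T -> L) :
  weak_cvg (fun n => mx_law (family_sum (X n) (Y n))) (law (family_sum Z D)) ->
  weak_cvg (fun n => mx_law (X n)) (law Z).
Proof.
move=> h p; have := h (bpoly_map inl p); rewrite /law beval_map.
by apply: near_norm_cvg; near=> n; rewrite /mx_law beval_map.
Unshelve. all: end_near. Qed.

Theorem theorem6p3 (R : realType) (B : cstarAlgType R) (A : bprobSpace B)
  (S T : Type) (a : forall n : nat, S -> 'I_n -> 'I_n -> A)
  (eta : S -> {linear B -> B})
  (Y1 : forall n s (i j : 'I_n), a n s i j = star (a n s j i))
  (Y2 : forall n s (i j : 'I_n), bexp A (a n s i j) = 0)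
  (Y3cp : forall s, completely_positive (eta s))
  (Y3 : forall n s (i j : 'I_n) (b : B),
    bexp A (a n s i j * binj A b * a n s j i) = (n%:R^-1 : R[i]) *: eta s b)
  (Y4 : forall m : nat, (0 < m)%N -> exists2 M : R, 0 < M &
    forall (n : nat) (b : nat -> B) (s : nat -> S) (i j : nat -> 'I_n),
      cnorm (bexp A ((\prod_(k < m.-1)
                        (a n (s k) (i k) (j k) * binj A (b k))) *
                     a n (s m.-1) (i m.-1) (j m.-1)))
      <= M * (n%:R `^ (- (m%:R / 2))) * \prod_(k < m.-1) cnorm (b k))
  (Y5 : forall n : nat, boolean_independent
    (fun q : S * {ij : 'I_n * 'I_n | (ij.1 <= ij.2)%N} =>
       a n q.1 (val q.2).1 (val q.2).2)) :
  let Zn (n : nat) (s : S) : 'M[A]_n := \matrix_(i, j) a n s i j in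
  exists (A1 : bprobSpace B) (Z1 : S -> A1),
    [/\ boolean_bernoulli Z1,
        weak_cvg (fun n => mx_law (Zn n)) (law Z1)
      & forall b : forall n : nat, T -> 'I_n -> B,
        let Dn (n : nat) (t : T) : 'M[B]_n := diag_mx (\row_i b n t i) in
        let Dn' (n : nat) (t : T) : 'M[A]_n := map_mx (binj A) (Dn n t) in
        forall (A0 : bprobSpace B) (D0 : T -> A0)
          (D1 : weak_cvg (fun n => mx_law (Dn' n)) (law D0))
          (D2 : forall (t : T) (k : nat),
            (mx_cstar_norm (Dn n t) ^+ k * (n%:R^-1)%:E)%E
              @[n --> \oo] --> 0%E)
          (D3 : forall (t : T) (k : nat),
            (limn_esup (fun n : nat =>
               (n%:R^-1 * \sum_i cnorm (b n t i) ^+ k)%:E) < +oo)%E),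
        exists (A2 : bprobSpace B) (Z : S -> A2) (D : T -> A2),
          [/\ boolean_bernoulli Z /\ law Z =1 law Z1,
              law D =1 law D0,
              weak_cvg (fun n => mx_law (family_sum (Zn n) (Dn' n)))
                       (law (family_sum Z D))
            & forall (m : nat) (s : nat -> S) (P : nat -> A2), (0 < m)%N ->
              (forall k, (k <= m)%N -> gen_algebra D (P k)) ->
              let lhs := bexp A2 ((\prod_(k < m) (P k * Z (s k))) * P m) in
              let paired := ~~ odd m /\ le_ker (nseq m./2 2%N) s in
              (paired -> lhs =
                bexp A2 ((\prod_(k < m./2)
                  (P k.*2 *
                   binj A2 (eta (s k.*2) (bexp A2 (P k.*2.+1))))) * P m)) /\
              (~ paired -> lhs = 0)]].
Proof.
move=> Zn.
(* The random matrices alone are the case of an empty family of diagonal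
   matrices. *)
pose b0 (n : nat) (t : void) (i : 'I_n) : B := match t with end.
pose phi0 (P : bpoly B void) : B := beval id star (fun t : void => 0) P.
have diag0 P n i : diag_poly b0 P n i = phi0 P.
  by congr (beval id star _ P); apply: funext => -[].
have D0_cvg : weak_cvg (fun n => mx_law (@Dmx _ _ A _ b0 n)) phi0.
  move=> P; apply: near_norm_cvg (norm_cvg_cst (phi0 P)); near=> n.
  have n0 : (0 < n)%N by near: n; exact: nbhs_infty_gt.
  rewrite /mx_law beval_diag -[LHS](mean_cst _ n0); congr (_ *: _).
  by apply: eq_bigr => i _; rewrite mxE eqxx mulr1n mxE bexp_binj diag0.
have [A1 [Z1 [D1' [Z1_star _ Z1_cvg Z1_law]]]] := @joint_limit R B A S void a eta
  Y1 Y2 Y3 Y4 Y5 b0 phi0 (fun t => match t with end) (fun t => match t with end)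
  D0_cvg.
have {}Z1_cvg := weak_cvg_inl Z1_cvg.
exists A1, Z1; split=> //; first exact: bernoulli_of_word_law Z1_star Z1_law.
move=> b Dn Dn' A0 D0 D1 D2 D3.
have [A2 [Z [D [Z_star D_law ZD_cvg ZD_law]]]] := @joint_limit R B A S T a eta
  Y1 Y2 Y3 Y4 Y5 b (law D0)
  (fun t => small_array_diag (D2 t)) (fun t => tame_array_limn_esup (D3 t)) D1.
exists A2, Z, D; split=> //.
- split; first exact: bernoulli_of_word_law Z_star ZD_law.
  by move=> p; apply: norm_limit_unique (Z1_cvg p); exact: (weak_cvg_inl ZD_cvg).
- by move=> m s P _ PD lhs; exact: (moments_of_word_law ZD_law s PD).
Unshelve. all: end_near. Qed.
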